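(* Assume that, along the sequence $(\lambda,\Sigma)=(\lambda_n,\Sigma_n)$: (C.1) the eigenvalues of $\Sigma\,(Z^T(I-\tilde A(\lambda))Z+\Sigma)^{-1}\Sigma$ are bounded from above (uniformly in $n$); (C.2) $nR_1(\lambda,\Sigma)\to\infty$ as $n\to\infty$; (C.4) $R_1(\lambda,\Sigma)-R_2(\lambda,\Sigma)=o(R_1(\lambda,\Sigma))$ as $n\to\infty$. Then, as $n\to\infty$, $$U(\lambda,\Sigma)-L_2(\lambda,\Sigma)-\frac1n\varepsilon^T\varepsilon=o_p(L_2(\lambda,\Sigma)).$$ If, in addition, (C.3) $\{n^{-1}\mathrm{tr}\,A(\lambda,\Sigma)\}^2/\{n^{-1}\mathrm{tr}\,A^2(\lambda,\Sigma)\}\to0$ as $n\to\infty$, then $$V(\lambda,\Sigma)-L_2(\lambda,\Sigma)-\frac1n\varepsilon^T\varepsilon=o_p(L_2(\lambda,\Sigma)).$$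
   Context: Model. For each $n$ one observes $Y_i=\eta(x_i)+\mathbf z_i^T\mathbf b+\varepsilon_i$, $i=1,\dots,n$, with fixed design points $x_i\in\mathcal X$ and $\mathbf z_i\in\mathbb R^p$, an unknown (nonrandom) function $\eta$ on $\mathcal X$, random effects $\mathbf b\sim N(\mathbf 0,B)$ in $\mathbb R^p$, and errors $\varepsilon_i\sim N(0,\sigma^2)$ independent of each other and of $\mathbf b$; $\sigma^2>0$ is fixed. The dimension $p$ may depend on $n$; the eigenvalues of the $p\times p$ matrix $B$ are bounded uniformly in $n$. Write $\mathbf Y=(Y_1,\dots,Y_n)^T$, $\boldsymbol\eta=(\eta(x_1),\dots,\eta(x_n))^T$, $\varepsilon=(\varepsilon_1,\dots,\varepsilon_n)^T$, and let $Z$ be the $n\times p$ matrix with rows $\mathbf z_i^T$, so $\mathbf Y=\boldsymbol\eta+Z\mathbf b+\varepsilon$. Estimator. Given functions $\xi_1,\dots,\xi_q$ on $\mathcal X$ ($q$ may depend on $n$) and a quadratic roughness functional $J$ (a square seminorm), let $R$ be the $n\times q$ matrix with entries $\xi_j(x_i)$ and $Q$ the $q\times q$ nonnegative definite matrix with entries $J(\xi_j,\xi_k)$. For $\lambda>0$ and a symmetric positive definite $p\times p$ matrix $\Sigma$ (both tuning parameters), one minimizes $(\mathbf Y-R\mathbf c-Z\mathbf b)^T(\mathbf Y-R\mathbf c-Z\mathbf b)+\mathbf b^T\Sigma\mathbf b+n\lambda\,\mathbf c^TQ\mathbf c$ over $\mathbf c,\mathbf b$. It is assumed throughout that the normal equations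 are solvable, i.e. the columns of $\binom{R^T}{Z^T}$ lie in the column space of $\begin{pmatrix}R^TR+n\lambda Q&R^TZ\\Z^TR&Z^TZ+\Sigma\end{pmatrix}$. $C^+$ denotes the Moore–Penrose inverse of $C$. The minimizer is $$\begin{pmatrix}\hat{\mathbf c}\\\hat{\mathbf b}\end{pmatrix}=\begin{pmatrix}R^TR+n\lambda Q&R^TZ\\Z^TR&Z^TZ+\Sigma\end{pmatrix}^{+}\begin{pmatrix}R^T\mathbf Y\\Z^T\mathbf Y\end{pmatrix},$$ and $\hat{\boldsymbol\eta}=R\hat{\mathbf c}=M\mathbf Y$, where, with $D=Z^TZ+\Sigma$ and $E=R^TR+n\lambda Q-R^TZD^{-1}Z^TR$, $M=RE^+R^T(I-ZD^{-1}Z^T)$. The smoothing matrix is $$A=A(\lambda,\Sigma)=(R,Z)\begin{pmatrix}R^TR+n\lambda Q&R^TZ\\Z^TR&Z^TZ+\Sigma\end{pmatrix}^{+}\begin{pmatrix}R^T\\Z^T\end{pmatrix},$$ so that the fitted values are $\hat{\mathbf Y}=R\hat{\mathbf c}+Z\hat{\mathbf b}=A\mathbf Y$, and $\tilde A(\lambda)=R(R^TR+n\lambda Q)^+R^T$ is the smoothing matrix when random effects are absent. Losses and risks. Let $P_Z=Z(Z^TZ)^+Z^T$ and $P_Z^\perp=I-P_Z$. Put $$L_1(\lambda,\Sigma)=\frac1n\sum_{i=1}^n(\hat Y_i-\eta(x_i)-\mathbf z_i^T\mathbf b)^2,\qquad L_2(\lambda,\Sigma)=\frac1n(\hat{\boldsymbol\eta}-\boldsymbol\eta)^TP_Z^\perp(\hat{\boldsymbol\eta}-\boldsymbol\eta),$$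 $R_1=E[L_1]$, $R_2=E[L_2]$, with expectation over $\mathbf b$ and $\varepsilon$. Scores: $$U(\lambda,\Sigma)=\frac1n\mathbf Y^T(I-A)^2\mathbf Y+\frac2n\sigma^2\,\mathrm{tr}\,A,\qquad V(\lambda,\Sigma)=\frac{n^{-1}\mathbf Y^T(I-A)^2\mathbf Y}{\{n^{-1}\mathrm{tr}(I-A)\}^2}.$$ Asymptotics are as $n\to\infty$ along nonrandom sequences $(\lambda,\Sigma)=(\lambda_n,\Sigma_n)$; $X_n=o_p(W_n)$ means $X_n/W_n\to0$ in probability. *)

(* Defs.v *)
From HB Require Import structures.
From mathcomp Require Import all_boot all_order all_algebra.
From mathcomp Require Import all_classical all_reals all_analysis.

Set Implicit Arguments.
Unset Strict Implicit.
Unset Printing Implicit Defensive.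

Import Order.TTheory GRing.Theory Num.Theory.
Import numFieldNormedType.Exports.

Local Open Scope classical_set_scope.
Local Open Scope ring_scope.

Section LinearAlgebra.
Context {R : realType}.

(* [quad M y] is the scalar y^T M y. *)
Definition quad n (M : 'M[R]_n) (y : 'cV[R]_n) : R := (y^T *m M *m y) 0 0.

Definition psdmx n (M : 'M[R]_n) : Prop :=
  M \is symmetricmx /\ forall y : 'cV[R]_n, 0 <= quad M y.

Definition pdmx n (M : 'M[R]_n) : Prop :=
  M \is symmetricmx /\ forall y : 'cV[R]_n, y != 0 -> 0 < quad M y.

(* The four Penrose equations. *)
Definition is_mpinv m n (C : 'M[R]_(m, n)) (X : 'M[R]_(n, m)) : Prop :=
  [/\ C *m X *m C = C, X *m C *m X = X,
      (C *m X)^T = C *m X & (X *m C)^T = X *m C].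

Definition mpinv m n (C : 'M[R]_(m, n)) : 'M[R]_(n, m) := xget 0 (is_mpinv C).

Lemma mulmx_tr_eq0 m n (v : 'M[R]_(m, n)) : v *m v^T = 0 -> v = 0.
Proof.
move=> h; apply/matrixP => i j; rewrite mxE.
have := congr1 (fun M : 'M[R]_m => M i i) h; rewrite !mxE => /eqP.
rewrite psumr_eq0 => [/allP/(_ j)|k _]; last by rewrite mxE -expr2 sqr_ge0.
by rewrite mem_index_enum mxE -expr2 sqrf_eq0 => /(_ isT)/eqP.
Qed.

Lemma row_free_gram m n (G : 'M[R]_(m, n)) :
  row_free G -> G *m G^T \in unitmx.
Proof.
move=> Gf; rewrite -row_free_unit -kermx_eq0; set K := kermx _.
have K0 : K *m (G *m G^T) = 0 by exact: mulmx_ker.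
have KG0 : K *m G = 0.
  by apply: mulmx_tr_eq0; rewrite trmx_mul !mulmxA -[K *m G *m _]mulmxA K0 mul0mx.
by apply/eqP/(row_free_inj Gf); rewrite KG0 mul0mx.
Qed.

Lemma mpinv_exists m n (C : 'M[R]_(m, n)) : exists X, is_mpinv C X.
Proof.
have [r [F [G [CE uF uG]]]] : exists r (F : 'M[R]_(m, r)) (G : 'M[R]_(r, n)),
    [/\ C = F *m G, F^T *m F \in unitmx & G *m G^T \in unitmx].
  exists (\rank C), (col_base C), (row_base C); split.
  - by rewrite mulmx_base.
  - rewrite -{2}[col_base C]trmxK; apply: row_free_gram.
    by rewrite /row_free mxrank_tr; exact: col_base_full.
  - by apply: row_free_gram; exact: row_base_free.
pose gi := invmx (G *m G^T); pose fi := invmx (F^T *m F).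
have giT : gi^T = gi by rewrite /gi trmx_inv trmx_mul trmxK.
have fiT : fi^T = fi by rewrite /fi trmx_inv trmx_mul trmxK.
pose X := G^T *m gi *m fi *m F^T.
have CX : C *m X = F *m fi *m F^T.
  rewrite CE /X; rewrite -!mulmxA; congr (F *m _); rewrite !mulmxA.
  by rewrite mulmxV // mul1mx.
have XC : X *m C = G^T *m gi *m G.
  rewrite CE /X -!mulmxA; congr (G^T *m (gi *m _)).
  by rewrite (mulmxA F^T) mulmxA mulVmx // mul1mx.
exists X; split.
- by rewrite CX {1}CE -!mulmxA (mulmxA F^T) (mulmxA fi) mulVmx // mul1mx -CE.
- rewrite XC /X -!mulmxA; congr (G^T *m (gi *m _)).
  by rewrite (mulmxA G) (mulmxA (G *m G^T)) mulmxV // mul1mx.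
- by rewrite CX !trmx_mul trmxK fiT mulmxA.
- by rewrite XC !trmx_mul trmxK giT mulmxA.
Qed.

Lemma is_mpinv_uniq m n (C : 'M[R]_(m, n)) X Y :
  is_mpinv C X -> is_mpinv C Y -> X = Y.
Proof.
move=> [x1 x2 x3 x4] [y1 y2 y3 y4].
have CXY : C *m X = C *m Y.
  rewrite -x3 -[in LHS]y1 -mulmxA trmx_mul x3 y3.
  by rewrite mulmxA x1.
have XCY : X *m C = Y *m C.
  rewrite -x4 -[in LHS]y1 !mulmxA -(mulmxA _ Y) trmx_mul x4 y4.
  by rewrite -mulmxA (mulmxA C) x1.
by rewrite -x2 XCY -mulmxA CXY mulmxA y2.
Qed.

Lemma mpinvP m n (C : 'M[R]_(m, n)) : is_mpinv C (mpinv C).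
Proof. by have [X hX] := mpinv_exists C; exact: (xgetPex 0 (ex_intro (is_mpinv C) X hX)). Qed.

End LinearAlgebra.

Section Smoother.
Context {R : realType} {n p q : nat}.
Variables (Rm : 'M[R]_(n, q)) (Z : 'M[R]_(n, p)) (Q : 'M[R]_q)
  (lambda : R) (Sigma : 'M[R]_p).

Definition normal_mx : 'M[R]_(q + p) :=
  block_mx (Rm^T *m Rm + (n%:R * lambda) *: Q) (Rm^T *m Z)
           (Z^T *m Rm) (Z^T *m Z + Sigma).

(* [(A <= B)%MS] compares row spaces, hence the transposes: the columns of
   (R^T ; Z^T) lie in the column space of [normal_mx]. *)
Definition normal_solvable : bool :=
  ((col_mx Rm^T Z^T)^T <= normal_mx^T)%MS.

Definition coef_hat (Y : 'cV[R]_n) : 'cV[R]_(q + p) :=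
  mpinv normal_mx *m col_mx (Rm^T *m Y) (Z^T *m Y).

Definition c_hat (Y : 'cV[R]_n) : 'cV[R]_q := usubmx (coef_hat Y).
Definition b_hat (Y : 'cV[R]_n) : 'cV[R]_p := dsubmx (coef_hat Y).
Definition eta_hat (Y : 'cV[R]_n) : 'cV[R]_n := Rm *m c_hat Y.
Definition Y_hat (Y : 'cV[R]_n) : 'cV[R]_n := Rm *m c_hat Y + Z *m b_hat Y.

(* A(lambda, Sigma) *)
Definition smooth_mx : 'M[R]_n :=
  row_mx Rm Z *m mpinv normal_mx *m col_mx Rm^T Z^T.

(* \tilde A(lambda) *)
Definition smooth_mx_fixed : 'M[R]_n :=
  Rm *m mpinv (Rm^T *m Rm + (n%:R * lambda) *: Q) *m Rm^T.

(* P_Z *)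
Definition proj_range : 'M[R]_n := Z *m mpinv (Z^T *m Z) *m Z^T.

(* In the losses, [eta] is the vector of the values eta(x_i). *)
Definition loss1 (eta : 'cV[R]_n) (b : 'cV[R]_p) (Y : 'cV[R]_n) : R :=
  n%:R^-1 * \sum_(i < n) (Y_hat Y i 0 - eta i 0 - (Z *m b) i 0) ^+ 2.

Definition loss2 (eta Y : 'cV[R]_n) : R :=
  n%:R^-1 * quad (1%:M - proj_range) (eta_hat Y - eta).

Definition score_U (sigma : R) (Y : 'cV[R]_n) : R :=
  n%:R^-1 * quad ((1%:M - smooth_mx) *m (1%:M - smooth_mx)) Y
  + 2 / n%:R * sigma ^+ 2 * \tr smooth_mx.

Definition score_V (Y : 'cV[R]_n) : R :=
  n%:R^-1 * quad ((1%:M - smooth_mx) *m (1%:M - smooth_mx)) Y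
  / (n%:R^-1 * \tr (1%:M - smooth_mx)) ^+ 2.

End Smoother.

(* A square seminorm J with domain [H]: J f g is the symmetric nonnegative
   bilinear form whose diagonal is the quadratic functional; its values
   outside [H] are irrelevant. *)
Definition square_seminorm (R : realType) (X : Type) (H : {pred X -> R})
    (J : (X -> R) -> (X -> R) -> R) : Prop :=
  [/\ submod_closed H,
      {in H &, forall f g, J f g = J g f},
      forall a, {in H & &, forall f g h, J (a *: f + g) h = a * J f h + J g h}
    & {in H, forall f, 0 <= J f f}].

Section Probability.
Context {R : realType}.

(* [normal_prob m 0] is not the point mass at m, and [normal_prob] takes a
   standard deviation. *)
Definition normal_law (m v : R) (A : set R) : \bar R :=
  if v == 0 then \d_m A else normal_prob m (Num.sqrt v) A.

Context {d : measure_display} {T : measurableType d} (P : probability T R).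

Definition rvec p (b : 'I_p -> {RV P >-> R}) (w : T) : 'cV[R]_p :=
  \col_j b j w.

Definition has_normal_law (X : T -> R) (m v : R) : Prop :=
  forall A : set R, measurable A -> P (X @^-1` A) = normal_law m v A.

(* Multivariate normality, with B possibly singular: every linear combination
   is univariate normal with the corresponding mean and variance. *)
Definition is_mvnormal p (b : 'I_p -> {RV P >-> R}) (mu : 'cV[R]_p)
    (B : 'M[R]_p) : Prop :=
  forall a : 'cV[R]_p,
    has_normal_law (fun w => (a^T *m rvec b w) 0 0)
                   ((a^T *m mu) 0 0) (quad B a).

(* Mutual independence of a finite family of sigma-algebras. *)
Definition mutually_independent (I : finType) (F : I -> set (set T)) : Prop :=
  forall (S : {set I}) (E : I -> set T), (forall i, i \in S -> F i (E i)) ->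
    P (\bigcap_(i in [set` S]) E i) = (\prod_(i in S) P (E i))%E.

(* Index [None] stands for the whole vector b, [Some i] for eps_i. *)
Definition model_sigma n p (eps : 'I_n -> {RV P >-> R})
    (b : 'I_p -> {RV P >-> R}) (k : option 'I_n) : set (set T) :=
  if k is Some i then preimage_set_system setT (eps i) measurable
  else g_sigma_preimage (fun j => b j : T -> R).

End Probability.

(* X_n = o_p(W_n), i.e. X_n / W_n tends to 0 in probability.  The quotient is
   undefined where W_n = 0, and Rocq's value 0 for it must not count as small:
   that event is required to have vanishing probability. *)
Definition little_op (R : realType) (d : nat -> measure_display)
    (T : forall n, measurableType (d n)) (P : forall n, probability (T n) R)
    (X W : forall n, T n -> R) : Prop :=
  forall e : R, 0 < e ->
    (fun n => P n [set w | W n w = 0 \/ e < `|X n w / W n w|]) @ \oo --> 0%E.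

(* Main.v *)
Require Import Defs.
From HB Require Import structures.
From mathcomp Require Import all_boot all_order all_algebra.
From mathcomp Require Import all_classical all_reals all_analysis.
From mathcomp Require Import measurable_realfun.
From mathcomp Require Import ring lra.

Set Implicit Arguments.
Unset Strict Implicit.
Unset Printing Implicit Defensive.

Import Order.TTheory GRing.Theory Num.Theory.
Import numFieldNormedType.Exports.

Local Open Scope classical_set_scope.
Local Open Scope ring_scope.

(** Let [A] be the smoothing matrix and [r = A Y - eta - Z b] the fit error, so
    that [n L1 = |r|^2].  Since [(1 - A) Y = eps - r], the score satisfies
    [n U = |r|^2 - 2 r^T eps + |eps|^2 + 2 sigma^2 tr A].  Now [r] is an affine
    function of the Gaussian vector [(b, eps)]; hence [L1 - R1] and
    [U - L1 - |eps|^2 / n] are, up to the factor [1 / n], centered polynomials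
    of degree two in that vector.  Their second moments are traces, computed by
    Isserlis' formula ([Ex_lin4_Isserlis], [Ex_dot_sqr]).

    These traces are at most a constant times [n R1] because [r] has a
    covariance matrix that is bounded as a form: the spectrum of [A] lies in
    [[0, 1]], the eigenvalues of [B] are bounded, and the boundedness of
    [Sigma (Z^T (1 - At) Z + Sigma)^-1 Sigma], with [At] the smoothing matrix
    of the fixed effects, bounds the operator norm of [(1 - A) Z]
    ([mixed_residual_le]).  So [L1 - R1] and [U - L1 - |eps|^2 / n] have second
    moments of order [R1 / n], and Chebyshev's inequality together with
    [n R1 --> +oo] makes both [o_p(R1)].

    The projection onto the orthogonal complement of the range of [Z] removes
    the random effects, so [n L2] is the squared norm of the corresponding part
    of [r].  Thus [0 <= L1 - L2], the mean [R1 - R2] of this difference is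
    [o(R1)] by hypothesis, and Markov's inequality gives [L1 - L2 = o_p(R1)].
    It follows that [L2 / R1] tends to [1] in probability, so that [o_p(R1)]
    and [o_p(L2)] are the same; this settles [U].

    With [a = tr A / n] one has [V = (U - 2 sigma^2 a) / (1 - a)^2].  The
    hypothesis on the traces gives [a --> 0] and [sigma^2 a^2 = o(R1)], because
    [sigma^2 tr (A^2) <= n R1].  Expanding [(1 - a)^-2 = 1 + 2 a + O(a^2)], the
    terms of order [a] cancel except for [2 a (|eps|^2 / n - sigma^2)], whose
    standard deviation is of order [a / sqrt n = o(R1)] ([little_op_gcv]).

    The noise enters through the moments of its linear functionals of order
    one, two and four.  They are transferred to a combination of [b] and [eps]
    by adding the independent [eps i] one at a time ([indep_from_add],
    [gauss1_sum]), and come from the one-dimensional normal law, where they are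
    obtained by integrating the derivatives of [x^k exp(- x^2 / 2 s^2)]. *)

(** * Quadratic forms *)

Section QuadraticForms.
Context {R : realType}.
Implicit Types (m n : nat).

Definition bil n (M : 'M[R]_n) (x y : 'cV[R]_n) : R := (x^T *m M *m y) 0 0.

Definition normsq n (y : 'cV[R]_n) : R := (y^T *m y) 0 0.

Lemma bilE n (M : 'M[R]_n) x y :
  bil M x y = \sum_i \sum_j x i 0 * M i j * y j 0.
Proof.
rewrite /bil mxE exchange_big /=; apply: eq_bigr => j _.
by rewrite mxE mulr_suml; apply: eq_bigr => i _; rewrite mxE.
Qed.

Lemma normsqE n (y : 'cV[R]_n) : normsq y = \sum_i y i 0 ^+ 2.
Proof. by rewrite /normsq mxE; apply: eq_bigr => i _; rewrite mxE expr2. Qed.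

Lemma normsq_ge0 n (y : 'cV[R]_n) : 0 <= normsq y.
Proof. by rewrite normsqE sumr_ge0// => i _; exact: sqr_ge0. Qed.

Lemma normsq_eq0 n (y : 'cV[R]_n) : normsq y = 0 -> y = 0.
Proof.
rewrite normsqE => /eqP; rewrite psumr_eq0 => [/allP h|i _]; last exact: sqr_ge0.
apply/matrixP => i j; rewrite ord1 mxE; apply/eqP.
by have := h i (mem_index_enum i); rewrite sqrf_eq0.
Qed.

Lemma normsq_gt0 n (y : 'cV[R]_n) : y != 0 -> 0 < normsq y.
Proof.
move=> y0; rewrite lt_neqAle normsq_ge0 andbT eq_sym.
by apply: contra y0 => /eqP/normsq_eq0 ->.
Qed.

Lemma normsqN n (y : 'cV[R]_n) : normsq (- y) = normsq y.
Proof. by rewrite !normsqE; apply: eq_bigr => i _; rewrite mxE sqrrN. Qed.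

Lemma bil_tr n (M : 'M[R]_n) x y : bil M^T x y = bil M y x.
Proof.
rewrite !bilE exchange_big /=; apply: eq_bigr => i _; apply: eq_bigr => j _.
by rewrite mxE; ring.
Qed.

Lemma bilC n (M : 'M[R]_n) x y : M^T = M -> bil M x y = bil M y x.
Proof. by move=> Ms; rewrite -{1}Ms bil_tr. Qed.

Lemma bilD n (M N : 'M[R]_n) x y : bil (M + N) x y = bil M x y + bil N x y.
Proof. by rewrite /bil mulmxDr mulmxDl mxE. Qed.

Lemma bilB n (M N : 'M[R]_n) x y : bil (M - N) x y = bil M x y - bil N x y.
Proof. by rewrite /bil mulmxBr mulmxBl !mxE. Qed.

Lemma bilDr n (M : 'M[R]_n) x y z : bil M x (y + z) = bil M x y + bil M x z.
Proof. by rewrite /bil mulmxDr mxE. Qed.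

Lemma bilDl n (M : 'M[R]_n) x y z : bil M (x + y) z = bil M x z + bil M y z.
Proof. by rewrite /bil linearD/= !mulmxDl mxE. Qed.

Lemma bilZr n (M : 'M[R]_n) x a y : bil M x (a *: y) = a * bil M x y.
Proof. by rewrite /bil -scalemxAr mxE. Qed.

Lemma bilZl n (M : 'M[R]_n) x a y : bil M (a *: x) y = a * bil M x y.
Proof. by rewrite /bil linearZ/= -!scalemxAl mxE. Qed.

Lemma bil_mulmx m n (M : 'M[R]_n) (F G : 'M[R]_(n, m)) x y :
  bil M (F *m x) (G *m y) = bil (F^T *m M *m G) x y.
Proof. by rewrite /bil trmx_mul !mulmxA. Qed.

Lemma quad_mulmx m n (M : 'M[R]_n) (F : 'M[R]_(n, m)) x :
  quad M (F *m x) = quad (F^T *m M *m F) x.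
Proof. exact: bil_mulmx. Qed.

Lemma quad_scalar n (a : R) (y : 'cV[R]_n) : quad a%:M y = a * normsq y.
Proof. by rewrite /quad mul_mx_scalar -scalemxAl mxE. Qed.

Lemma normsq_mulmx m n (F : 'M[R]_(n, m)) y : normsq (F *m y) = quad (F^T *m F) y.
Proof. by rewrite /normsq /quad trmx_mul !mulmxA. Qed.

Lemma psdmx_sym n (M : 'M[R]_n) : psdmx M -> M^T = M.
Proof. by case=> /is_hermitianmxP; rewrite expr0 scale1r map_mx_id. Qed.

Lemma psdmxI n (M : 'M[R]_n) : M^T = M -> (forall y, 0 <= quad M y) -> psdmx M.
Proof.
by move=> h1 h2; split=> //; apply/is_hermitianmxP; rewrite expr0 scale1r map_mx_id.
Qed.

Lemma psd_quad_ge0 n (M : 'M[R]_n) y : psdmx M -> 0 <= quad M y.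
Proof. by case. Qed.

Lemma quadDZ n (M : 'M[R]_n) x y t : M^T = M ->
  quad M (x + t *: y) = quad M x + 2 * t * bil M x y + t ^+ 2 * quad M y.
Proof.
move=> Ms; rewrite -![quad _ _]/(bil _ _ _) !bilDl !bilDr !bilZl !bilZr.
by rewrite (bilC y x Ms); ring.
Qed.

(** The discriminant of the nonnegative polynomial [t |-> quad M (x + t y)]. *)
Lemma psd_CauchySchwarz n (M : 'M[R]_n) x y : psdmx M ->
  bil M x y ^+ 2 <= quad M x * quad M y.
Proof.
move=> pM; have h t : 0 <= quad M x + 2 * t * bil M x y + t ^+ 2 * quad M y.
  by rewrite -quadDZ ?psdmx_sym//; case: pM.
have a0 : 0 <= quad M y by case: pM.
have [a1|a1] := eqVneq (quad M y) 0.
  have [b0|b0] := eqVneq (bil M x y) 0; first by rewrite b0 a1 mulr0 expr0n.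
  (* Here the polynomial is affine; at this point it equals -1. *)
  have := h (- (quad M x + 1) / (2 * bil M x y)).
  rewrite a1 mulr0 addr0.
  rewrite (_ : 2 * _ * _ = - (quad M x + 1)); last by field.
  lra.
have := h (- bil M x y / quad M y).
rewrite (_ : _ + _ = quad M x - bil M x y ^+ 2 / quad M y); last by field.
by rewrite subr_ge0 ler_pdivrMr// lt_def a1.
Qed.

Lemma tr_quad n (M : 'M[R]_n) : \tr M = \sum_i quad M (delta_mx i 0).
Proof.
apply: eq_bigr => i _; rewrite -[quad _ _]/(bil _ _ _) bilE.
rewrite (bigD1 i)//= (bigD1 i)//= !mxE !eqxx mul1r mulr1.
rewrite big1 ?addr0 => [|j ji]; last by rewrite !mxE (negbTE ji) mulr0.
rewrite big1 ?addr0// => j ji; rewrite big1// => k _.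
by rewrite !mxE (negbTE ji) !mul0r.
Qed.

Lemma psd_tr_ge0 n (M : 'M[R]_n) : psdmx M -> 0 <= \tr M.
Proof. by move=> [_ h]; rewrite tr_quad sumr_ge0. Qed.

Lemma tr_gram_eq0 m n (A : 'M[R]_(m, n)) : \tr (A^T *m A) = 0 -> A = 0.
Proof.
rewrite tr_quad => /eqP; rewrite psumr_eq0 => [/allP h|j _]; last first.
  by rewrite -normsq_mulmx normsq_ge0.
apply/matrixP => i j; have := h j (mem_index_enum j).
rewrite -normsq_mulmx => /eqP/normsq_eq0; rewrite -colE => /matrixP/(_ i 0).
by rewrite !mxE.
Qed.

(** Semidefiniteness gives [|M y|^2 = (M y)^T M y <= quad M (M y) ^ (1/2) *
    quad M y ^ (1/2)], and [quad M (M y)] is at most [C |M y|^2]. *)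
Lemma psd_normsq_le n (M : 'M[R]_n) C y : psdmx M ->
  (forall x, quad M x <= C * normsq x) -> normsq (M *m y) <= C * quad M y.
Proof.
move=> pM h; have [->|n0] := eqVneq (normsq (M *m y)) 0.
  have [y0|y0] := eqVneq y 0; first by rewrite y0 /quad mulmx0 mxE mulr0.
  have q0 : 0 <= quad M y by case: pM.
  have y1 := normsq_gt0 y0.
  rewrite mulr_ge0//; have := le_trans q0 (h y).
  by rewrite pmulr_lge0.
have n1 : 0 < normsq (M *m y) by rewrite lt_def n0 normsq_ge0.
have := psd_CauchySchwarz (M *m y) y pM.
rewrite (_ : bil _ _ _ = normsq (M *m y)); last by rewrite /bil /normsq mulmxA.
have q0 : 0 <= quad M y by case: pM.
move=> /le_trans/(_ (ler_wpM2r q0 (h (M *m y)))).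
by rewrite expr2 mulrAC ler_pM2r.
Qed.

Lemma psd_tr_sqr_le n (M : 'M[R]_n) C : psdmx M ->
  (forall x, quad M x <= C * normsq x) -> \tr (M *m M) <= C * \tr M.
Proof.
move=> pM h; rewrite !tr_quad mulr_sumr; apply: ler_sum => i _.
by rewrite -{1}(psdmx_sym pM) -normsq_mulmx psd_normsq_le.
Qed.

Lemma quad_bounded n (M : 'M[R]_n) :
  exists2 k : R, 0 < k & forall y, quad M y <= k * normsq y.
Proof.
exists (1 + \sum_i \sum_j `|M i j|).
  by rewrite ltr_wpDr// sumr_ge0// => i _; rewrite sumr_ge0.
move=> y; rewrite -[quad _ _]/(bil _ _ _) bilE mulrDl mul1r.
apply: (@le_trans _ _ ((\sum_i \sum_j `|M i j|) * normsq y)); last first.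
  by rewrite lerDr normsq_ge0.
rewrite mulr_suml; apply: ler_sum => i _.
rewrite mulr_suml; apply: ler_sum => j _.
have ynorm k : y k 0 ^+ 2 <= normsq y.
  by rewrite normsqE (bigD1 k)//= lerDl sumr_ge0// => l _; exact: sqr_ge0.
apply: (le_trans (ler_norm _)); rewrite !normrM mulrAC mulrC ler_wpM2l//.
have := ynorm i; have := ynorm j; rewrite -(real_normK (num_real (y i 0))).
rewrite -(real_normK (num_real (y j 0))).
have := sqr_ge0 (`|y i 0| - `|y j 0|); nra.
Qed.

(** The infimum [c] of the upper bounds of the Rayleigh quotient of [M] is an
    eigenvalue.  Otherwise [c - M], which is semidefinite, would be invertible,
    hence bounded below by a positive constant, namely the inverse of a bound
    for the form of its inverse; then [c] could be decreased. *)
Lemma eigenvalue_quad_le n (M : 'M[R]_n) C : M^T = M ->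
  (forall a, eigenvalue M a -> a <= C) ->
  forall y, quad M y <= C * normsq y.
Proof.
move=> Ms hC y; have [y0|y0] := eqVneq y 0.
  by rewrite y0 /quad mulmx0 mxE /normsq mulmx0 mxE mulr0.
pose S := [set t : R | forall x, quad M x <= t * normsq x].
have [k0 _ k0S] := quad_bounded M.
have Slb x : x != 0 -> lbound S (quad M x / normsq x).
  by move=> x0 t; rewrite ler_pdivrMr ?normsq_gt0.
have hS : has_inf S.
  by split; [exists k0; exact: k0S|exists (quad M y / normsq y); exact: Slb].
have infS : S (inf S).
  move=> x; have [x0|x0] := eqVneq x 0.
    by rewrite x0 /quad mulmx0 mxE /normsq mulmx0 mxE mulr0.
  by rewrite -ler_pdivrMr ?normsq_gt0// lb_le_inf//; [case: hS|exact: Slb].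
suff cC : inf S <= C.
  by apply: (le_trans (infS y)); rewrite ler_wpM2r// normsq_ge0.
rewrite leNgt; apply/negP => Cc; set c := inf S in infS Cc *.
pose D := c%:M - M.
have Ds : D^T = D by rewrite /D linearB/= tr_scalar_mx Ms.
have qD x : quad D x = c * normsq x - quad M x.
  by rewrite -quad_scalar; exact: bilB.
have pD : psdmx D by apply: psdmxI => // x; rewrite qD subr_ge0; exact: infS.
have uD : D \in unitmx.
  rewrite -row_free_unit -kermx_eq0; apply/negPn/negP => k.
  have : eigenvalue M c.
    rewrite /eigenvalue /eigenspace; apply: contra k => /eqP k.
    by rewrite -submx0 -k; apply/sub_kermxP; rewrite -opprB mulmxN mulmx_ker oppr0.
  by move=> /hC; rewrite leNgt Cc.
have [k kp hk] := quad_bounded (invmx D).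
have low x : normsq x <= k * quad D x.
  have [n0|n0] := eqVneq (normsq x) 0; first by rewrite n0 mulr_ge0 ?(ltW kp)//; case: pD.
  have n1 : 0 < normsq x by rewrite lt_def n0 normsq_ge0.
  have := psd_CauchySchwarz x (invmx D *m x) pD.
  rewrite /bil -mulmxA (mulmxA D) mulmxV// mul1mx -/(normsq x).
  rewrite quad_mulmx trmx_inv Ds mulVmx// mul1mx.
  have qD0 : 0 <= quad D x by case: pD.
  move=> /le_trans/(_ (ler_wpM2l qD0 (hk x))).
  by rewrite expr2 mulrA ler_pM2r// mulrC.
have : S (c - k^-1).
  move=> x; rewrite mulrBl lerBrDl -lerBrDr -qD.
  by rewrite mulrC ler_pdivrMr// mulrC low.
move=> /(ge_inf (proj2 hS)); rewrite -/c lerBrDr gerDl invr_le0 leNgt kp//.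
Qed.

End QuadraticForms.

(** * Penalized least squares smoothers *)

Section Smoothers.
Context {R : realType}.
Implicit Types (m n : nat).

Lemma psd_gram m n (W : 'M[R]_(n, m)) : psdmx (W^T *m W).
Proof.
apply: psdmxI => [|y]; first by rewrite trmx_mul trmxK.
by rewrite -normsq_mulmx normsq_ge0.
Qed.

Lemma psdD n (M N : 'M[R]_n) : psdmx M -> psdmx N -> psdmx (M + N).
Proof.
move=> pM pN; apply: psdmxI => [|y]; first by rewrite linearD/= !psdmx_sym.
by rewrite -[quad _ _]/(bil _ _ _) bilD addr_ge0//; exact: psd_quad_ge0.
Qed.

Lemma psd_congr m n (M : 'M[R]_n) (F : 'M[R]_(n, m)) :
  psdmx M -> psdmx (F^T *m M *m F).
Proof.
move=> pM; apply: psdmxI => [|y].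
  by rewrite !trmx_mul trmxK (psdmx_sym pM) mulmxA.
by rewrite -quad_mulmx; case: pM.
Qed.

Lemma psd_scale n a (M : 'M[R]_n) : 0 <= a -> psdmx M -> psdmx (a *: M).
Proof.
move=> a0 pM; apply: psdmxI => [|y]; first by rewrite linearZ/= psdmx_sym.
by rewrite /quad -scalemxAr -scalemxAl mxE mulr_ge0//; exact: psd_quad_ge0.
Qed.

Lemma psd0 n : psdmx (0 : 'M[R]_n).
Proof. by apply: psdmxI => [|y]; rewrite ?trmx0// /quad mulmx0 mul0mx mxE. Qed.

Lemma quad_block_diag m n (M : 'M[R]_m) (N : 'M[R]_n) y :
  quad (block_mx M 0 0 N) y = quad M (usubmx y) + quad N (dsubmx y).
Proof.
rewrite -{1}[y]vsubmxK /quad tr_col_mx mul_row_block !mulmx0 addr0 add0r.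
by rewrite mul_row_col mxE.
Qed.

Lemma psd_block_diag m n (M : 'M[R]_m) (N : 'M[R]_n) :
  psdmx M -> psdmx N -> psdmx (block_mx M 0 0 N).
Proof.
move=> pM pN; apply: psdmxI => [|y].
  by rewrite tr_block_mx !trmx0 (psdmx_sym pM) (psdmx_sym pN).
by rewrite quad_block_diag addr_ge0//; exact: psd_quad_ge0.
Qed.

Lemma mpinv_tr n (C : 'M[R]_n) : C^T = C -> (mpinv C)^T = mpinv C.
Proof.
move=> Cs; apply: (@is_mpinv_uniq _ _ _ C); last exact: mpinvP.
have [x1 x2 x3 x4] := mpinvP C.
have CX : C *m (mpinv C)^T = mpinv C *m C by rewrite -x4 trmx_mul Cs.
have XC : (mpinv C)^T *m C = C *m mpinv C by rewrite -x3 trmx_mul Cs.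
split; [| | by rewrite CX x4 | by rewrite XC x3].
- by rewrite -[in RHS]Cs -[in RHS]x1 !trmx_mul Cs mulmxA.
- by rewrite -[in RHS]x2 !trmx_mul Cs mulmxA.
Qed.

(** The matrix sending [Y] to the fit [W c], with [c] minimizing
    [|Y - W c|^2 + c^T S c]. *)
Definition ridge m n (W : 'M[R]_(n, m)) (S : 'M[R]_m) : 'M[R]_n :=
  W *m mpinv (W^T *m W + S) *m W^T.

Section Ridge.
Variables (m n : nat) (W : 'M[R]_(n, m)) (S : 'M[R]_m).
Hypothesis pS : psdmx S.
Let N := W^T *m W + S.
Let pN : psdmx N. Proof. exact: psdD (psd_gram W) pS. Qed.
Let A := ridge W S.

(** The kernel of [W^T W + S] is contained in that of [W]; so the normal
    equations are solvable for every right-hand side [W^T Y]. *)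
Lemma ridge_range : W *m mpinv N *m N = W.
Proof.
have [x1 _ _ _] := mpinvP N.
apply/eqP; rewrite eq_sym -subr_eq0; apply/eqP.
have -> : W - W *m mpinv N *m N = W *m (1%:M - mpinv N *m N).
  by rewrite mulmxBr mulmx1 mulmxA.
set D := 1%:M - _.
have ND : N *m D = 0 by rewrite /D mulmxBr mulmx1 mulmxA x1 subrr.
apply/matrixP => i j; rewrite [RHS]mxE.
suff /matrixP/(_ i 0) : W *m (D *m delta_mx j 0 : 'cV_m) = 0.
  by rewrite mulmxA -colE !mxE.
apply: normsq_eq0; apply/eqP; rewrite eq_le normsq_ge0 andbT.
have: bil N (D *m delta_mx j 0) (D *m delta_mx j 0) = 0.
  by rewrite /bil -[_ *m N *m _]mulmxA (mulmxA N) ND mul0mx mulmx0 mxE.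
rewrite bilD -![bil _ _ _]/(quad _ _) -normsq_mulmx => <-.
by rewrite lerDl; exact: psd_quad_ge0.
Qed.

Lemma ridge_sym : A^T = A.
Proof.
by rewrite /A /ridge !trmx_mul trmxK (mpinv_tr (psdmx_sym pN)) mulmxA.
Qed.

(** [A - A^2] is congruent to the penalty [S].  This puts the spectrum of [A]
    in [[0, 1]], and every bound on [A] below is a consequence. *)
Lemma ridge_sub_sqr_psd : psdmx (A - A *m A).
Proof.
have [_ x2 _ _] := mpinvP N; have Ns := mpinv_tr (psdmx_sym pN).
rewrite (_ : _ - _ = (mpinv N *m W^T)^T *m S *m (mpinv N *m W^T)).
  exact: psd_congr.
rewrite trmx_mul trmxK Ns /A /ridge -/N.
have -> : S = N - W^T *m W by rewrite /N addrC addKr.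
rewrite mulmxBr mulmxBl -!mulmxA; congr (W *m _ - _).
by rewrite !mulmxA x2.
Qed.

Lemma quad_ridge_sqr_le y : normsq (A *m y) <= quad A y.
Proof.
rewrite normsq_mulmx ridge_sym -subr_ge0 -[_ - _]bilB.
exact: psd_quad_ge0 ridge_sub_sqr_psd.
Qed.

Lemma quad_1B_ridge y : quad (1%:M - A) y = normsq y - quad A y.
Proof. by rewrite -[LHS]/(bil _ _ _) bilB -[bil 1%:M _ _]/(quad _ _) quad_scalar mul1r. Qed.

Lemma normsq_1B_ridge y :
  normsq ((1%:M - A) *m y) = normsq y - 2 * quad A y + normsq (A *m y).
Proof.
rewrite mulmxBl mul1mx !normsq_mulmx ridge_sym.
have -> : normsq (y - A *m y) = quad ((1%:M - A)^T *m (1%:M - A)) y.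
  by rewrite -normsq_mulmx mulmxBl mul1mx.
have -> : (1%:M - A)^T = 1%:M - A by rewrite linearB/= trmx1 ridge_sym.
rewrite mulmxBl !mulmxBr !mul1mx mulmx1.
rewrite -[LHS]/(bil _ _ _) !bilB -[bil 1%:M _ _]/(quad _ _) quad_scalar mul1r.
by rewrite -![bil _ y y]/(quad _ y); ring.
Qed.

Lemma ridge_le1 y : quad A y <= normsq y.
Proof.
have := normsq_ge0 ((1%:M - A) *m y); rewrite normsq_1B_ridge.
have := quad_ridge_sqr_le y; lra.
Qed.

Lemma normsq_ridge_le y : normsq (A *m y) <= normsq y.
Proof. exact: le_trans (quad_ridge_sqr_le y) (ridge_le1 y). Qed.

Lemma normsq_1B_ridge_le y : normsq ((1%:M - A) *m y) <= quad (1%:M - A) y.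
Proof.
rewrite normsq_1B_ridge quad_1B_ridge; have := quad_ridge_sqr_le y; lra.
Qed.

Lemma tr_ridge_sqr_le : \tr (A *m A) <= \tr A.
Proof. by rewrite -subr_ge0 -raddfB; exact: psd_tr_ge0 ridge_sub_sqr_psd. Qed.

(** A fit can thus be computed from any solution of the normal equations,
    without the generalized inverse. *)
Lemma ridge_fit (Y : 'cV[R]_n) c : N *m c = W^T *m Y -> A *m Y = W *m c.
Proof.
by move=> h; rewrite /A /ridge -[_ *m W^T *m _]mulmxA -h mulmxA ridge_range.
Qed.

End Ridge.

(** Without a penalty [ridge] is the orthogonal projection onto the range. *)
Lemma ridge0_fix m n (Z : 'M[R]_(n, m)) : ridge Z 0 *m Z = Z.
Proof.
have := ridge_range Z (psd0 m); rewrite addr0 mulmxA => h.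
by rewrite /ridge addr0 h.
Qed.

Lemma ridge0_idem m n (Z : 'M[R]_(n, m)) : ridge Z 0 *m ridge Z 0 = ridge Z 0.
Proof. by rewrite {2}/ridge !mulmxA ridge0_fix. Qed.

Section MixedRidge.
Variables (n p q : nat) (Rm : 'M[R]_(n, q)) (Z : 'M[R]_(n, p)).
Variables (S : 'M[R]_q) (Sigma : 'M[R]_p).
Hypotheses (pS : psdmx S) (pSigma : pdmx Sigma).
Let A := ridge (row_mx Rm Z) (block_mx S 0 0 Sigma).
Let At := ridge Rm S.
Let H := Z^T *m (1%:M - At) *m Z + Sigma.

Lemma pdmx_psd : psdmx Sigma.
Proof.
case: pSigma => h1 h2; split=> // y; have [->|/h2/ltW//] := eqVneq y 0.
by rewrite /quad mulmx0 mxE.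
Qed.

Lemma mixed_psd : psdmx (block_mx S 0 0 Sigma).
Proof. exact: psd_block_diag pS pdmx_psd. Qed.

Lemma schur_sym : H^T = H.
Proof.
have e : (1%:M - At)^T = 1%:M - At by rewrite linearB/= trmx1 (ridge_sym Rm pS).
rewrite /H linearD/= !trmx_mul trmxK e.
by rewrite (psdmx_sym pdmx_psd) mulmxA.
Qed.

Lemma quad_schur y : quad H y = quad (1%:M - At) (Z *m y) + quad Sigma y.
Proof. by rewrite quad_mulmx -[LHS]/(bil _ _ _) bilD. Qed.

Lemma schur_unit : H \in unitmx.
Proof.
rewrite -row_free_unit -kermx_eq0; apply/rowV0P => v /sub_kermxP vH.
apply/eqP/negPn/negP => v0.
have v1 : v^T != 0 by apply: contra v0 => /eqP h; rewrite -[v]trmxK h trmx0.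
have : quad H v^T = 0 by rewrite /quad trmxK vH mul0mx mxE.
rewrite quad_schur; apply/eqP; rewrite gt_eqF// ltr_wpDl//; last first.
  by case: pSigma => _; apply.
by rewrite quad_1B_ridge subr_ge0 ridge_le1.
Qed.

(** Eliminating the fixed effects from the normal equations for the data
    [Z v]: the shrinkage of [Z v] is governed by the Schur complement [H]. *)
Lemma mixed_residual (v : 'cV[R]_p) :
  (1%:M - A) *m (Z *m v) = (1%:M - At) *m (Z *m (invmx H *m (Sigma *m v))).
Proof.
set u := invmx H *m (Sigma *m v).
pose G := Rm^T *m Rm + S; pose c := mpinv G *m (Rm^T *m (Z *m u)).
have pG : psdmx G by exact: psdD (psd_gram Rm) pS.
have GR : G *m mpinv G *m Rm^T = Rm^T.
  have := congr1 trmx (ridge_range Rm pS).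
  by rewrite -/G !trmx_mul (mpinv_tr (psdmx_sym pG)) (psdmx_sym pG) mulmxA.
have Hu : H *m u = Sigma *m v by rewrite mulmxA mulmxV ?schur_unit// mul1mx.
have Rc : Rm *m c = At *m (Z *m u) by rewrite /c /At /ridge !mulmxA.
rewrite !mulmxBl !mul1mx.
suff -> : A *m (Z *m v) = Rm *m c + Z *m (v - u).
  by rewrite Rc mulmxBr opprD opprB addrCA [Z *m v + _]addrC subrK addrC.
rewrite (@ridge_fit _ _ (row_mx Rm Z) _ mixed_psd (Z *m v) (col_mx c (v - u))) ?mul_row_col//.
rewrite tr_row_mx mul_col_row add_block_mx !addr0 mul_block_col mul_col_mx.
congr col_mx.
  by rewrite -/G /c 2!mulmxA GR mulmxA -mulmxDr addrC subrK mulmxA.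
rewrite -[Z^T *m Rm *m c]mulmxA Rc mulmxDl -[Z^T *m Z *m _]mulmxA !mulmxBr.
have -> : Sigma *m v =
    Z^T *m (Z *m u) - Z^T *m (At *m (Z *m u)) + Sigma *m u.
  by rewrite -mulmxBr -Hu /H mulmxDl -2!mulmxA mulmxBl mul1mx.
by rewrite addrK addrCA [X in _ + X]addrC !subrK.
Qed.

(** The form [|(I - A) Z v|^2] is at most that of [Sigma H^-1 Sigma], because
    [(I - At)^2 <= I - At] and [Z^T (I - At) Z <= H]. *)
Lemma mixed_residual_le C (v : 'cV[R]_p) :
  (forall a, eigenvalue (Sigma *m invmx H *m Sigma) a -> a <= C) ->
  normsq ((1%:M - A) *m (Z *m v)) <= C * normsq v.
Proof.
move=> hC; have Ss := psdmx_sym pdmx_psd.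
rewrite mixed_residual; set u := invmx H *m _.
apply: (le_trans (normsq_1B_ridge_le Rm pS _)).
apply: (@le_trans _ _ (quad H u)).
  by rewrite quad_schur lerDl; case: pdmx_psd.
rewrite /u !mulmxA quad_mulmx trmx_mul trmx_inv schur_sym Ss.
rewrite !mulmxA mulmxKV ?schur_unit//.
apply: eigenvalue_quad_le => //.
by rewrite !trmx_mul trmx_inv schur_sym Ss mulmxA.
Qed.

End MixedRidge.

End Smoothers.

(** * Moments of the centered normal law *)

Section NormalMoments.
Context {R : realType}.
Notation mu := (@lebesgue_measure R).

(** By dominated convergence the integral is the limit of the integrals over
    [[-n, n]], which the fundamental theorem of calculus evaluates. *)
Lemma integral_derive_eq0 (F f : R -> R) :
  (forall x : R, is_derive x 1 F (f x)) -> continuous f ->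
  mu.-integrable setT (EFin \o f) ->
  (fun n => F n.+1%:R - F (- n.+1%:R)) @ \oo --> (0 : R) ->
  (\int[mu]_x (f x)%:E = 0)%E.
Proof.
move=> dF cf fi F0; pose I n := `[- n.+1%:R, n.+1%:R]%classic : set R.
have FTC n : (\int[mu]_(x in I n) (f x)%:E = (F n.+1%:R - F (- n.+1%:R))%:E)%E.
  rewrite /I (@continuous_FTC2 _ f F)//.
  - by rewrite gtrN.
  - exact: continuous_subspaceT.
  - have cF : continuous F.
      by move=> x; apply: differentiable_continuous; apply/derivable1_diffP;
         have := dF x; case.
    by split=> [x _| |]; [have [] := dF x|apply: cvg_at_right_filter; exact: cF|
       apply: cvg_at_left_filter; exact: cF].
  - by move=> x _; rewrite derive1E; have [_] := dF x.
have mI n : measurable (I n) by exact: measurable_itv.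
have cvgI : (fun n => (\int[mu]_(x in I n) (f x)%:E)%E) @ \oo -->
    (\int[mu]_x (f x)%:E)%E.
  under eq_fun do rewrite integral_mkcond.
  have mf := measurable_int mu fi.
  apply: (@dominated_cvg _ _ _ mu setT measurableT _ _ (fun x => `|f x|%:E)) => //.
  - move=> n; apply/(measurable_restrictT _ (mI n)); exact: measurable_funTS mf.
  - move=> x _; apply/cvg_ballP => e e0.
    near=> n; rewrite patchE ifT; first exact: ballxx.
    rewrite inE /I/= in_itv/= -ler_norml.
    near: n; exists (Num.bound `|x|) => // n /= xn.
    apply: (le_trans (ltW (archi_boundP (normr_ge0 x)))).
    by rewrite ler_nat ltnW.
  - by have /integrable_norm := fi.
  - move=> n x _; rewrite patchE; case: ifP => _ //=.
    by rewrite normr0 lee_fin.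
have : (fun n => (F n.+1%:R - F (- n.+1%:R))%:E) @ \oo --> (0%:E : \bar R).
  by apply: cvg_EFin; [exact: nearW|exact: F0].
move: cvgI; under eq_fun do rewrite FTC.
by move=> h1 h2; exact: (cvg_unique _ h1 h2).
Unshelve. all: by end_near.
Qed.

Section GaussIntegrals.
Variable s : R.
Hypothesis s0 : 0 < s.

Definition gauss_mono k (x : R) := x ^+ k * normal_fun 0 s x.

Lemma is_derive_gauss_mono k (x : R) :
  is_derive x 1 (gauss_mono k)
    (k%:R * gauss_mono k.-1 x - (s ^+ 2)^-1 * gauss_mono k.+1 x).
Proof.
have dg : is_derive x 1 (normal_fun 0 s) (- (s ^+ 2)^-1 * x * normal_fun 0 s x).
  have dh : is_derive x 1 (fun y : R => - (y - 0) ^+ 2 / (s ^+ 2 *+ 2))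
      (- (s ^+ 2)^-1 * x).
    apply: is_derive_eq; rewrite /GRing.scale/=.
    field; exact: lt0r_neq0.
  rewrite mulrC; exact: (is_derive1_comp (is_derive_expR _) dh).
have dX := is_deriveX k (is_derive_id x (1 : R)).
rewrite (_ : gauss_mono k = (id ^+ k) * normal_fun 0 s); last first.
  by apply/funext => y; rewrite fctE /gauss_mono exprfctE.
apply: is_derive_eq; rewrite /GRing.scale/= /gauss_mono exprfctE (exprS x k).
ring.
Qed.

(** Trading part of the exponent for the monomial: with [y = 3 x^2 / (8 s^2)]
    the exponential of standard deviation [s] is [exp (- y)] times that of
    standard deviation [2 s], and [y^2 exp (- y) <= 2]. *)
Lemma gauss_mono_bound k (x : R) : (k <= 4)%N ->
  `|gauss_mono k x| <= (1 + 2 * (8 / 3 * s ^+ 2) ^+ 2) * normal_fun 0 (2 * s) x.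
Proof.
move=> k4; rewrite /gauss_mono normrM (ger0_norm (normal_fun_ge0 _ _ _)).
have xk : `|x ^+ k| <= 1 + x ^+ 4.
  rewrite normrX -[x ^+ 4]ger0_norm ?exprn_even_ge0// normrX.
  have [x1|x1] := leP `|x| 1.
    by rewrite (le_trans (exprn_ile1 _ _ x1))// lerDl exprn_ge0.
  by rewrite (le_trans (ler_weXn2l (ltW x1) k4))// lerDr.
pose y := x ^+ 2 / (8 / 3 * s ^+ 2).
have s20 : 0 < s ^+ 2 by rewrite exprn_gt0.
have s80 : 0 < 8 / 3 * s ^+ 2 by rewrite mulr_gt0.
have y0 : 0 <= y by rewrite divr_ge0 ?sqr_ge0 ?ltW.
have -> : normal_fun 0 s x = expR (- y) * normal_fun 0 (2 * s) x.
  rewrite /normal_fun -expRD; congr expR; rewrite /y; field; exact: lt0r_neq0.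
rewrite mulrA ler_wpM2r ?normal_fun_ge0//.
apply: (le_trans (ler_wpM2r (expR_ge0 _) xk)); rewrite mulrDl mul1r lerD//.
  by rewrite -expR0 ler_expR oppr_le0.
have -> : x ^+ 4 = y ^+ 2 * (8 / 3 * s ^+ 2) ^+ 2.
  by rewrite /y; field; exact: lt0r_neq0.
rewrite mulrAC ler_wpM2r ?sqr_ge0//.
rewrite expRN ler_pdivrMr ?expR_gt0//.
by have := expR_ge1Dxn 1 y0; rewrite (_ : 2`! = 2%N)//; lra.
Qed.

Lemma continuous_gauss_mono k : continuous (gauss_mono k).
Proof.
move=> x; apply: differentiable_continuous; apply/derivable1_diffP.
by have [] := is_derive_gauss_mono k x.
Qed.

Let bound := 1 + 2 * (8 / 3 * s ^+ 2) ^+ 2.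

Let bound_ge0 : 0 <= bound.
Proof. by rewrite addr_ge0// mulr_ge0// sqr_ge0. Qed.

Lemma integrable_normal_fun : mu.-integrable setT (EFin \o normal_fun 0 (2 * s)).
Proof.
have s1 : 2 * s != 0 by rewrite gt_eqF// mulr_gt0.
have -> : EFin \o normal_fun 0 (2 * s) =
    (fun x => (normal_peak (2 * s))^-1%:E * (normal_pdf 0 (2 * s) x)%:E)%E.
  apply/funext => x /=; rewrite -EFinM normal_pdfE// mulKf//.
  by rewrite gt_eqF// normal_peak_gt0.
by apply: integrableZl => //; exact: integrable_normal_pdf.
Qed.

Lemma integrable_gauss_mono k : (k <= 4)%N ->
  mu.-integrable setT (EFin \o gauss_mono k).
Proof.
move=> k4.
have h := integrableZl measurableT bound integrable_normal_fun.
apply: le_integrable h => //.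
- apply/measurable_EFinP; apply: measurable_funM; first exact: exprn_measurable.
  exact: measurable_normal_fun.
- move=> x _ /=; rewrite lee_fin [leRHS]ger0_norm.
    exact: gauss_mono_bound.
  by rewrite mulr_ge0// normal_fun_ge0.
Qed.

Lemma gauss_mono_tail k n : (k <= 3)%N ->
  `|gauss_mono k n.+1%:R - gauss_mono k (- n.+1%:R)| <= 2 * bound / n.+1%:R.
Proof.
move=> k3.
have h (x : R) : `|x| = n.+1%:R -> `|gauss_mono k x| <= bound / n.+1%:R.
  move=> xn; rewrite ler_pdivlMr ?ltr0n// -xn mulrC -normrM mulrA -exprS.
  (* One more power of [x] is still bounded, whence the decay in [1 / n]. *)
  apply: (le_trans (gauss_mono_bound x (_ : k.+1 <= 4)%N)) => //.
  rewrite -[leRHS]mulr1 ler_wpM2l// /normal_fun -expR0 ler_expR.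
  by rewrite mulNr oppr_le0 divr_ge0 ?sqr_ge0// mulrn_wge0 ?sqr_ge0.
apply: (le_trans (ler_normB _ _)); rewrite -mulrA mulr_natl mulr2n.
by apply: lerD; apply: h; rewrite ?normrN normr_nat.
Qed.

Definition gauss_moment k := (\int[mu]_x gauss_mono k x)%R.

(** The derivative of [gauss_mono k] has integral zero. *)
Lemma gauss_moment_rec k : (k <= 3)%N ->
  k%:R * gauss_moment k.-1 = (s ^+ 2)^-1 * gauss_moment k.+1.
Proof.
move=> k3.
have i1 := integrable_gauss_mono (leq_trans (leq_pred k) (leqW k3)).
have i2 := integrable_gauss_mono (k3 : k.+1 <= 4)%N.
pose f x := k%:R * gauss_mono k.-1 x - (s ^+ 2)^-1 * gauss_mono k.+1 x.
have fi : mu.-integrable setT (EFin \o f).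
  exact: (integrableB measurableT (integrableZl measurableT k%:R i1)
    (integrableZl measurableT (s ^+ 2)^-1 i2)).
have : (\int[mu]_x (f x)%:E = 0)%E.
  apply: (integral_derive_eq0 (is_derive_gauss_mono k)) => //.
    by move=> x; apply: cvgB; (apply: cvgM; [exact: cvg_cst|exact: continuous_gauss_mono]).
  apply/norm_cvg0P; apply: (squeeze_cvgr (f := cst 0) (h := fun n : nat => 2 * bound / n.+1%:R)).
  - by apply: nearW => n /=; rewrite normr_ge0 gauss_mono_tail.
  - exact: cvg_cst.
  - rewrite -[X in _ --> X](mulr0 (2 * bound)).
    by apply: cvgM; [exact: cvg_cst|exact: cvg_harmonic].
move=> /(congr1 fine) /=; rewrite -[LHS]/(Rintegral mu setT f) RintegralB//.
- by rewrite !RintegralZl// => /eqP; rewrite subr_eq0 => /eqP.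
- exact: (integrableZl measurableT k%:R i1).
- exact: (integrableZl measurableT (s ^+ 2)^-1 i2).
Qed.

(** Integrals against the normal law are integrals against its density: the
    density is a version of the Radon-Nikodym derivative. *)
Lemma ge0_integral_normal_prob (f : R -> \bar R) :
  measurable_fun setT f -> (forall x, 0 <= f x)%E ->
  (\int[normal_prob 0 s]_x f x = \int[mu]_x (f x * (normal_pdf 0 s x)%:E))%E.
Proof.
move=> mf f0; have dom := normal_prob_dominates 0 s.
rewrite -(Radon_Nikodym_SigmaFinite.change_of_variables dom)//.
have mpdf : measurable_fun setT (EFin \o normal_pdf 0 s).
  by apply/measurable_EFinP; exact: measurable_normal_pdf.
have iRN := Radon_Nikodym_SigmaFinite.f_integrable dom.
apply: ae_eq_integral => //.
- by apply: emeasurable_funM => //; exact: measurable_int iRN.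
- exact: emeasurable_funM.
- apply: ae_eqe_mul2l; apply: integral_ae_eq => // E _ mE.
  by rewrite -Radon_Nikodym_SigmaFinite.f_integral.
Qed.

Lemma integrable_normal_prob k : (k <= 4)%N ->
  (normal_prob 0 s).-integrable setT (fun x => (x ^+ k)%:E).
Proof.
move=> k4; apply/integrableP; split.
  by apply/measurable_EFinP; exact: exprn_measurable.
rewrite ge0_integral_normal_prob//; last first.
  by apply: measurableT_comp => //; apply/measurable_EFinP; exact: exprn_measurable.
have /integrableP[_] := integrableZl measurableT (normal_peak s) (integrable_gauss_mono k4).
apply: le_lt_trans; rewrite le_eqVlt; apply/orP; left; apply/eqP.
apply: eq_integral => x _ /=; rewrite -EFinM; congr EFin.
rewrite normal_pdfE ?gt_eqF// normrM normrM.
rewrite [X in _ = X * _]ger0_norm ?normal_peak_ge0//.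
by rewrite [X in _ = _ * (_ * X)]ger0_norm ?normal_fun_ge0//; ring.
Qed.

Lemma Rintegral_normal_prob k : (k <= 4)%N ->
  \int[normal_prob 0 s]_x (x ^+ k) = normal_peak s * gauss_moment k.
Proof.
move=> k4; rewrite -RintegralZl//; last exact: integrable_gauss_mono.
have mk : measurable_fun setT (fun x : R => (x ^+ k)%:E).
  by apply/measurable_EFinP; exact: exprn_measurable.
have pdfE x : normal_peak s * gauss_mono k x = x ^+ k * normal_pdf 0 s x.
  by rewrite normal_pdfE ?gt_eqF// /gauss_mono mulrCA.
rewrite /Rintegral; congr fine.
rewrite integralE [in RHS]integralE !ge0_integral_normal_prob//; last 2 first.
- exact: measurable_funeneg.
- exact: measurable_funepos.
congr (_ - _)%E; apply: eq_integral => x _.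
- rewrite !funeposE pdfE EFinM maxe_pMl ?mul0e//.
  by rewrite lee_fin normal_pdf_ge0.
- rewrite !funenegE pdfE -!EFinN -mulNr EFinM maxe_pMl ?mul0e//.
  by rewrite lee_fin normal_pdf_ge0.
Qed.

Lemma normal_prob_moments :
  [/\ \int[normal_prob 0 s]_x (x ^+ 1) = 0,
      \int[normal_prob 0 s]_x (x ^+ 2) = s ^+ 2
    & \int[normal_prob 0 s]_x (x ^+ 4) = 3 * (s ^+ 2) ^+ 2].
Proof.
have m0 : normal_peak s * gauss_moment 0 = 1.
  rewrite -Rintegral_normal_prob// /Rintegral.
  under eq_integral do rewrite expr0.
  by rewrite integral_cst// mul1e /= (@probability_setT _ _ _ (normal_prob 0 s)).
have s20 : s ^+ 2 != 0 by rewrite expf_neq0// gt_eqF.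
have m1 := gauss_moment_rec (isT : 0 <= 3)%N.
have m2 := gauss_moment_rec (isT : 1 <= 3)%N.
have m4 := gauss_moment_rec (isT : 3 <= 3)%N.
rewrite /= in m1 m2 m4.
have {}m1 : gauss_moment 1 = 0.
  by apply: (mulfI (invr_neq0 s20)); rewrite -m1 mul0r mulr0.
have {}m2 : gauss_moment 2 = s ^+ 2 * gauss_moment 0.
  by apply: (mulfI (invr_neq0 s20)); rewrite -m2 mulKf// mul1r.
have {}m4 : gauss_moment 4 = 3 * s ^+ 2 * gauss_moment 2.
  by apply: (mulfI (invr_neq0 s20)); rewrite -m4; field; exact: lt0r_neq0.
rewrite !Rintegral_normal_prob// m4 m2 m1; split.
- by rewrite mulr0.
- by rewrite mulrCA m0 mulr1.
- by rewrite -[RHS]mulr1 -m0; ring.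
Qed.

End GaussIntegrals.
End NormalMoments.

(** * Independence *)

Section Independence.
Context {R : realType} {d : measure_display} {T : measurableType d}.
Variable P : probability T R.

Definition Ex (X : T -> R) : R := Rintegral P setT X.

Definition indep2 (X Y : T -> R) : Prop := forall A B,
  measurable A -> measurable B ->
  P (X @^-1` A `&` Y @^-1` B) = (P (X @^-1` A) * P (Y @^-1` B))%E.

Definition pair_rv (X Y : {RV P >-> R}) : {mfun T >-> (R * R)%type} :=
  mfun_Sub (mem_set (measurable_fun_pair (measurable_funPT X) (measurable_funPT Y))).

Lemma indep2_law (X Y : {RV P >-> R}) : indep2 X Y ->
  forall C : set (R * R), measurable C ->
  (distribution P X \x distribution P Y)%E C = distribution P (pair_rv X Y) C.
Proof.
move=> XY; apply: (@product_measure_unique _ _ _ _ R (distribution P X)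
  (distribution P Y) (distribution P (pair_rv X Y))) => A B mA mB.
exact: XY.
Qed.

(** The law of the pair is the product of the laws, and Fubini's theorem
    factors the integral of the product. *)
Lemma Ex_indep2 (X Y : {RV P >-> R}) : indep2 X Y ->
  P.-integrable setT (EFin \o X) -> P.-integrable setT (EFin \o Y) ->
  P.-integrable setT (EFin \o (fun w => X w * Y w)) ->
  Ex (fun w => X w * Y w) = Ex X * Ex Y.
Proof.
move=> XY iX iY iXY; set mX := distribution P X; set mY := distribution P Y.
have mid : measurable_fun setT (EFin : R -> \bar R) by exact/measurable_EFinP.
pose f (z : R * R) := (z.1 * z.2)%:E.
have mf : measurable_fun setT f.
  by apply/measurable_EFinP; apply: measurable_funM; [exact: measurable_fst|exact: measurable_snd].
have lawE : (\int[(mX \x mY)%E]_z f z = \int[P]_w (X w * Y w)%:E)%E.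
  rewrite (eq_measure_integral (distribution P (pair_rv X Y))) => [|C mC _].
    by rewrite integral_distribution.
  exact: indep2_law.
have absE : (\int[(mX \x mY)%E]_z `|f z| = \int[P]_w `|(X w * Y w)%:E|)%E.
  rewrite (eq_measure_integral (distribution P (pair_rv X Y))) => [|C mC _].
    by rewrite ge0_integral_distribution//; exact: measurableT_comp.
  exact: indep2_law.
have iprod : (mX \x mY)%E.-integrable setT f.
  by apply/integrableP; split=> //; rewrite absE; case/integrableP: iXY.
have iY' : mY.-integrable setT EFin.
  apply/integrableP; split=> //.
  rewrite ge0_integral_distribution//; last exact: measurableT_comp.
  by case/integrableP: iY.
have iX' : mX.-integrable setT EFin.
  apply/integrableP; split=> //.
  rewrite ge0_integral_distribution//; last exact: measurableT_comp.
  by case/integrableP: iX.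
have ExE (Z : {RV P >-> R}) : P.-integrable setT (EFin \o Z) ->
    (\int[distribution P Z]_x x%:E = (Ex Z)%:E)%E.
  move=> iZ; rewrite integral_distribution// /Ex /Rintegral fineK//.
  exact: integrable_fin_num.
rewrite {1}/Ex /Rintegral -lawE -integral12_prod_meas1//.
have -> : (\int[mX]_x fubini_F mY f x = \int[mX]_x ((Ex Y)%:E * x%:E))%E.
  apply: eq_integral => x _; rewrite /fubini_F /f /=.
  under eq_integral do rewrite EFinM.
  by rewrite integralZl// ExE// muleC.
by rewrite integralZl// ExE// -EFinM /= mulrC.
Qed.

Section IndepFrom.
Context {I : finType}.
Variable eps : I -> {RV P >-> R}.

Definition joint (S : {set I}) (E : I -> set R) : set T :=
  [set w | forall i, i \in S -> E i (eps i w)].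

(** [X] is jointly independent of the family of the [eps i] with [i] in [S].
    All of [S] occurs in each event; the choice [E i = setT] removes an index. *)
Definition indep_from (X : T -> R) (S : {set I}) : Prop :=
  forall A E, measurable A -> (forall i, measurable (E i)) ->
  P (X @^-1` A `&` joint S E) =
  (P (X @^-1` A) * \prod_(i in S) P (eps i @^-1` E i))%E.

Lemma joint_measurable S E : (forall i, measurable (E i)) -> measurable (joint S E).
Proof.
move=> mE; rewrite (_ : joint S E = \bigcap_(i in [set` S]) (eps i @^-1` E i)).
  apply: fin_bigcap_measurable; first exact: finite_finset.
  by move=> i _; rewrite -[X in measurable X]setTI; exact: measurable_funPT.
by apply/seteqP; split.
Qed.

Lemma joint_setU1 i S E : joint (i |: S) E = eps i @^-1` E i `&` joint S E.
Proof.
apply/seteqP; split=> w /= => [h|[h1 h2] j].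
  by split=> [|j jS]; apply: h; rewrite !inE ?eqxx// jS orbT.
by rewrite !inE => /orP[/eqP->|/h2].
Qed.

Lemma indep_from_sub X i (S : {set I}) : i \notin S -> indep_from X (i |: S) -> indep_from X S.
Proof.
move=> iS h A E mA mE; pose E' j := if j == i then setT else E j.
have mE' j : measurable (E' j) by rewrite /E'; case: ifP.
have := h A E' mA mE'; rewrite joint_setU1 /E' eqxx preimage_setT setTI.
rewrite big_setU1//= eqxx preimage_setT probability_setT mul1e.
have eE j : j \in S -> E' j = E j.
  by rewrite /E'; case: eqP => // ->; rewrite (negbTE iS).
rewrite (_ : joint S _ = joint S E).
  by move=> ->; congr (_ * _)%E; apply: eq_bigr => j jS; rewrite -/(E' j) eE.
by apply/seteqP; split=> w hw j jS; have := hw j jS; rewrite -/(E' j) eE.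
Qed.

Lemma indep_from_indep2 X i (S : {set I}) : i \in S -> indep_from X S -> indep2 X (eps i).
Proof.
move=> iS h A B mA mB; pose E j := if j == i then B else setT.
have := h A E mA; rewrite (bigD1 i)//= {3}/E eqxx big1 => [|j /andP[_ ji]].
  rewrite mule1 => <-; last by move=> j; rewrite /E; case: ifP.
  congr (P (_ `&` _)); apply/seteqP; split=> w /=.
    by move=> Bw j _; rewrite /E; case: eqP => // ->.
  by move=> /(_ i iS); rewrite /E eqxx.
by rewrite /E (negbTE ji) preimage_setT probability_setT.
Qed.

Lemma indep_from_joint X S E : indep_from X S -> (forall i, measurable (E i)) ->
  P (joint S E) = (\prod_(i in S) P (eps i @^-1` E i))%E.
Proof.
move=> h mE; have := h setT E measurableT mE.
by rewrite preimage_setT setTI probability_setT mul1e.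
Qed.

(** Independence survives the absorption of one member of the family into [X].
    For a fixed event [G] of the other members, the restriction to [G] of the
    law of [(X, eps i)] and [P G] times that law agree on rectangles, hence
    everywhere, in particular on the preimages of [A] under the sum. *)
Lemma indep_from_add (X : {RV P >-> R}) i (S : {set I}) c : i \notin S ->
  indep_from X (i |: S) -> indep_from (fun w => X w + c * eps i w) S.
Proof.
move=> iS h A E mA mE; pose G := joint S E.
have mG : measurable G by exact: joint_measurable.
have hS := indep_from_sub iS h.
have PG : P G = (\prod_(i in S) P (eps i @^-1` E i))%E.
  exact: indep_from_joint hS mE.
have gE : ((fine (P G))%:E = P G)%E by rewrite fineK// fin_num_measure.
pose g : {nonneg R} := NngNum (fine_ge0 (measure_ge0 P G)).
pose XY := pair_rv X (eps i).
have XYi : indep2 X (eps i) by apply: indep_from_indep2 h; rewrite !inE eqxx.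
pose m2 := mscale g (distribution P (eps i)).
have rect1 A1 B1 : measurable A1 -> measurable B1 ->
    pushforward (mrestr P mG) XY (A1 `*` B1) = (distribution P X A1 * m2 B1)%E.
  move=> mA1 mB1; pose E' j := if j == i then B1 else E j.
  have mE' j : measurable (E' j) by rewrite /E'; case: ifP.
  have eE j : j \in S -> E' j = E j.
    by rewrite /E'; case: eqP => // ->; rewrite (negbTE iS).
  have jE : joint S E' = G.
    by apply/seteqP; split=> w hw j jS; have := hw j jS; rewrite eE.
  have := h A1 E' mA1 mE'; rewrite joint_setU1 jE {1}/E' eqxx setIA.
  rewrite big_setU1//= /E' eqxx.
  under eq_bigr => j jS do rewrite -/(E' j) eE//.
  rewrite -PG => e; rewrite /m2 /mscale /= gE [(P G * _)%E]muleC.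
  exact: e.
have rect2 A1 B1 : measurable A1 -> measurable B1 ->
    mscale g (distribution P XY) (A1 `*` B1) = (distribution P X A1 * m2 B1)%E.
  move=> mA1 mB1; rewrite /m2 /mscale /= muleCA; congr (_ * _)%E.
  exact: XYi.
pose C : set (R * R) := [set z | A (z.1 + c * z.2)].
have mC : measurable C.
  have mf : measurable_fun setT (fun z : R * R => z.1 + c * z.2).
    apply: measurable_funD; first exact: measurable_fst.
    by apply: measurable_funM => //; exact: measurable_snd.
  by rewrite -[C]setTI; exact: mf.
have e1 : (distribution P X \x m2)%E C = pushforward (mrestr P mG) XY C.
  exact: (product_measure_unique rect1).
have e2 : (distribution P X \x m2)%E C = mscale g (distribution P XY) C.
  exact: (product_measure_unique rect2).
have := etrans (esym e1) e2.
by rewrite /mscale /= gE PG muleC => <-.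
Qed.

End IndepFrom.
End Independence.

(** * Gaussian vectors through their moments *)

Section Expectation.
Context {R : realType} {d : measure_display} {T : measurableType d}.
Variable P : probability T R.

Local Notation itg X := (P.-integrable setT (EFin \o X)).
Local Notation E := (Ex P).

Lemma itg_ext (X Y : T -> R) : X =1 Y -> itg X -> itg Y.
Proof. by move=> /funext ->. Qed.

Lemma eq_Ex (X Y : T -> R) : X =1 Y -> E X = E Y.
Proof. by move=> /funext ->. Qed.

Lemma itgD (X Y : T -> R) : itg X -> itg Y -> itg (fun w => X w + Y w).
Proof. exact: (integrableD measurableT). Qed.

Lemma itgB (X Y : T -> R) : itg X -> itg Y -> itg (fun w => X w - Y w).
Proof. exact: (integrableB measurableT). Qed.

Lemma itgZ c (X : T -> R) : itg X -> itg (fun w => c * X w).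
Proof. exact: (integrableZl measurableT). Qed.

Lemma itg_cst c : itg (fun=> c).
Proof. exact: finite_measure_integrable_cst. Qed.

Lemma itg_sum (I : Type) (r : seq I) (F : I -> T -> R) :
  (forall i, itg (F i)) -> itg (fun w => \sum_(i <- r) F i w).
Proof.
move=> h; elim: r => [|i r ih].
  by apply: itg_ext (itg_cst 0) => w; rewrite big_nil.
by apply: itg_ext (itgD (h i) ih) => w; rewrite big_cons.
Qed.

Lemma itg_le (X Y : T -> R) : measurable_fun setT X -> itg Y ->
  (forall w, `|X w| <= Y w) -> itg X.
Proof.
move=> mX iY XY; apply: le_integrable iY => //; first exact/measurable_EFinP.
by move=> w _ /=; rewrite lee_fin (le_trans (XY w))// ler_norm.
Qed.

Lemma ExD (X Y : T -> R) : itg X -> itg Y -> E (fun w => X w + Y w) = E X + E Y.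
Proof. exact: RintegralD. Qed.

Lemma ExB (X Y : T -> R) : itg X -> itg Y -> E (fun w => X w - Y w) = E X - E Y.
Proof. exact: RintegralB. Qed.

Lemma ExZ c (X : T -> R) : itg X -> E (fun w => c * X w) = c * E X.
Proof. by move=> iX; exact: RintegralZl. Qed.

Lemma Ex_cst c : E (fun=> c) = c.
Proof. by rewrite /Ex Rintegral_cst//= probability_setT mulr1. Qed.

Lemma Ex_sum (I : Type) (r : seq I) (F : I -> T -> R) :
  (forall i, itg (F i)) ->
  E (fun w => \sum_(i <- r) F i w) = \sum_(i <- r) E (F i).
Proof.
move=> h; elim: r => [|i r ih].
  by rewrite big_nil -[RHS](Ex_cst 0); apply: eq_Ex => w; rewrite big_nil.
rewrite big_cons -ih -ExD//; last exact: itg_sum.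
by apply: eq_Ex => w; rewrite big_cons.
Qed.

Lemma Ex_ge0 (X : T -> R) : (forall w, 0 <= X w) -> 0 <= E X.
Proof. by move=> h; apply: Rintegral_ge0. Qed.

Lemma le_Ex (X Y : T -> R) : itg X -> itg Y -> (forall w, X w <= Y w) -> E X <= E Y.
Proof. by move=> iX iY XY; apply: le_Rintegral. Qed.

(** A class that contains the linear functionals of the noise and for which
    every product of at most four members is integrable. *)
Definition L4 (X : T -> R) : Prop :=
  measurable_fun setT X /\ itg (fun w => X w ^+ 4).

Lemma L4_cst c : L4 (fun=> c).
Proof. by split; [exact: measurable_cst|exact: itg_cst]. Qed.

Lemma normr_mul4_le (a b c e : R) :
  `|a * b * c * e| <= a ^+ 4 + b ^+ 4 + c ^+ 4 + e ^+ 4.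
Proof.
rewrite -mulrA; set x := a * b; set y := c * e.
have h1 := sqr_ge0 (`|x| - `|y|); have h2 := sqr_ge0 (a ^+ 2 - b ^+ 2).
have h3 := sqr_ge0 (c ^+ 2 - e ^+ 2).
have nx := real_normK (num_real x); have ny := real_normK (num_real y).
rewrite normrM; rewrite /x /y in nx ny h1 *; nra.
Qed.

Lemma itg_mul4 X1 X2 X3 X4 : L4 X1 -> L4 X2 -> L4 X3 -> L4 X4 ->
  itg (fun w => X1 w * X2 w * X3 w * X4 w).
Proof.
move=> [m1 i1] [m2 i2] [m3 i3] [m4 i4].
apply: itg_le (itgD (itgD (itgD i1 i2) i3) i4) _ => [|w].
  by do 3 (apply: measurable_funM => //).
exact: normr_mul4_le.
Qed.

Lemma itg_mul2 X1 X2 : L4 X1 -> L4 X2 -> itg (fun w => X1 w * X2 w).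
Proof.
move=> h1 h2; apply: itg_ext (itg_mul4 h1 h2 (L4_cst 1) (L4_cst 1)) => w.
by rewrite !mulr1.
Qed.

Lemma itg_L4 X : L4 X -> itg X.
Proof.
move=> h; apply: itg_ext (itg_mul2 h (L4_cst 1)) => w.
by rewrite mulr1.
Qed.

Lemma itg_sqr X : L4 X -> itg (fun w => X w ^+ 2).
Proof. by move=> h; apply: itg_ext (itg_mul2 h h) => w; rewrite expr2. Qed.

Lemma L4Z c X : L4 X -> L4 (fun w => c * X w).
Proof.
move=> [mX iX]; split; first exact: measurable_funM.
by apply: itg_ext (itgZ (c ^+ 4) iX) => w; rewrite exprMn.
Qed.

Lemma L4D X Y : L4 X -> L4 Y -> L4 (fun w => X w + Y w).
Proof.
move=> hX hY; split; first by apply: measurable_funD; [case: hX|case: hY].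
have i (Z1 Z2 Z3 Z4 : T -> R) := @itg_mul4 Z1 Z2 Z3 Z4.
have h := itgD (itgD (itgD (itgD (proj2 hX) (itgZ 4 (i _ _ _ _ hX hX hX hY)))
  (itgZ 6 (i _ _ _ _ hX hX hY hY))) (itgZ 4 (i _ _ _ _ hX hY hY hY))) (proj2 hY).
by apply: itg_ext h => w; ring.
Qed.

(** The moments of a centered normal variable of variance [v] that determine
    the second moment of a quadratic form.  The moment of order three can be
    left out: in the fourth power of an independent sum it is multiplied by a
    mean, which vanishes. *)
Definition gauss1 (X : T -> R) (v : R) : Prop :=
  [/\ L4 X, E X = 0, E (fun w => X w ^+ 2) = v
    & E (fun w => X w ^+ 4) = 3 * v ^+ 2].

Lemma gauss1_normal (X : {RV P >-> R}) v : 0 <= v ->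
  has_normal_law P X 0 v -> gauss1 X v.
Proof.
move=> v0 hX.
have mX : @measurable_fun _ _ T (measurableTypeR R) setT X.
  have mX : measurable_fun setT X by exact: measurable_funPT.
  move=> mT A mA; exact: (mX mT A mA).
pose X' : {mfun T >-> measurableTypeR R} := @mfun_Sub _ _ T (measurableTypeR R) X (mem_set mX).
have mk k : measurable_fun setT (fun x : measurableTypeR R => (x ^+ k)%:E).
  by apply/measurable_EFinP; exact: exprn_measurable.
have moment (m : {measure set (measurableTypeR R) -> \bar R}) k :
    (forall A, measurable A -> distribution P X' A = m A) ->
    m.-integrable setT (fun x => (x ^+ k)%:E) ->
    itg (fun w => X w ^+ k) /\ E (fun w => X w ^+ k) = (\int[m]_x (x ^+ k))%R.
  move=> law im.
  have iX : itg (fun w => X w ^+ k).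
    apply/integrableP; split.
      by apply/measurable_EFinP; exact: measurable_funX.
    have /integrableP[_] := im; apply: le_lt_trans.
    rewrite -(@eq_measure_integral _ _ _ _ m (distribution P X'))//; last first.
      by move=> A mA _; exact: law.
    rewrite ge0_integral_distribution//; exact: measurableT_comp.
  split=> //; rewrite /Ex /Rintegral; congr fine.
  rewrite -(@eq_measure_integral _ _ _ _ m (distribution P X'))//; last first.
    by move=> A mA _; exact: law.
  by rewrite integral_distribution.
have [v1|v1] := eqVneq v 0.
  pose d0 : {measure set (measurableTypeR R) -> \bar R} :=
    @dirac _ (measurableTypeR R) 0 R.
  have law A : measurable A -> distribution P X' A = d0 A.
    by move=> mA; rewrite [LHS]hX// /normal_law v1 eqxx.
  have im k : d0.-integrable setT (fun x => (x ^+ k)%:E).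
    apply/integrableP; split=> //.
    by rewrite integral_dirac//; [rewrite diracT mul1e ltry|exact: measurableT_comp].
  have Ek k : (\int[d0]_x (x ^+ k.+1))%R = 0.
    by rewrite /Rintegral integral_dirac// diracT mul1e expr0n.
  have [i1 e1] := moment d0 1 law (im 1); have [i2 e2] := moment d0 2 law (im 2).
  have [i4 e4] := moment d0 4 law (im 4).
  split; rewrite ?e2 ?e4 ?Ek ?v1 ?expr0n ?mulr0//.
  by rewrite -[RHS](Ek 0) -e1; apply: eq_Ex => w; rewrite expr1.
pose s := Num.sqrt v.
pose nu : {measure set (measurableTypeR R) -> \bar R} := normal_prob 0 s.
have s0 : 0 < s by rewrite sqrtr_gt0 lt_def v1.
have sv : s ^+ 2 = v by rewrite sqr_sqrtr.
have law A : measurable A -> distribution P X' A = normal_prob 0 s A.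
  by move=> mA; rewrite [LHS]hX// /normal_law (negbTE v1).
have [n1 n2 n4] := normal_prob_moments s0.
have [i1 e1] := moment nu 1 law (integrable_normal_prob s0 (isT : 1 <= 4)%N).
have [i2 e2] := moment nu 2 law (integrable_normal_prob s0 (isT : 2 <= 4)%N).
have [i4 e4] := moment nu 4 law (integrable_normal_prob s0 (isT : 4 <= 4)%N).
split; rewrite ?e2 ?e4 ?n2 ?n4 ?sv//.
by rewrite -[RHS]n1 -e1; apply: eq_Ex => w; rewrite expr1.
Qed.

Lemma gauss1Z c X v : gauss1 X v -> gauss1 (fun w => c * X w) (c ^+ 2 * v).
Proof.
move=> [lX e1 e2 e4]; split; first exact: L4Z.
- by rewrite ExZ ?e1 ?mulr0//; exact: itg_L4.
- rewrite -e2 -ExZ; last exact: itg_sqr.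
  by apply: eq_Ex => w; rewrite exprMn.
- rewrite exprMn mulrCA -e4 -exprM -ExZ; last by case: lX.
  by apply: eq_Ex => w; rewrite exprMn.
Qed.

Lemma indep2_comp (X Y : T -> R) (f g : R -> R) :
  measurable_fun setT f -> measurable_fun setT g ->
  indep2 P X Y -> indep2 P (f \o X) (g \o Y).
Proof.
move=> mf mg XY A B mA mB; apply: (XY (f @^-1` A) (g @^-1` B)).
- by rewrite -[X in measurable X]setTI; exact: mf.
- by rewrite -[X in measurable X]setTI; exact: mg.
Qed.

Lemma Ex_indep2_comp (X Y : T -> R) (f g : R -> R) :
  measurable_fun setT X -> measurable_fun setT Y ->
  measurable_fun setT f -> measurable_fun setT g -> indep2 P X Y ->
  itg (f \o X) -> itg (g \o Y) -> itg (fun w => f (X w) * g (Y w)) ->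
  E (fun w => f (X w) * g (Y w)) = E (f \o X) * E (g \o Y).
Proof.
move=> mX mY mf mg XY.
have mfX : measurable_fun setT (f \o X) by exact: measurableT_comp.
have mgY : measurable_fun setT (g \o Y) by exact: measurableT_comp.
pose X' : {RV P >-> R} := mfun_Sub (mem_set mfX).
pose Y' : {RV P >-> R} := mfun_Sub (mem_set mgY).
by apply: (@Ex_indep2 _ _ _ _ X' Y'); exact: indep2_comp.
Qed.

Lemma gauss1D X Y v u : gauss1 X v -> gauss1 Y u -> indep2 P X Y ->
  gauss1 (fun w => X w + Y w) (v + u).
Proof.
move=> [lX X1 X2 X4] [lY Y1 Y2 Y4] XY.
have [[mX iX4] [mY iY4]] := (lX, lY).
have iX := itg_L4 lX; have iY := itg_L4 lY.
have iX2 := itg_sqr lX; have iY2 := itg_sqr lY.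
have l1 := L4_cst 1.
have iX3 : itg (fun w => X w ^+ 3).
  by apply: itg_ext (itg_mul4 lX lX lX l1) => w; ring.
have iY3 : itg (fun w => Y w ^+ 3).
  by apply: itg_ext (itg_mul4 lY lY lY l1) => w; ring.
have i11 : itg (fun w => X w * Y w) := itg_mul2 lX lY.
have i31 : itg (fun w => X w ^+ 3 * Y w).
  by apply: itg_ext (itg_mul4 lX lX lX lY) => w; ring.
have i22 : itg (fun w => X w ^+ 2 * Y w ^+ 2).
  by apply: itg_ext (itg_mul4 lX lX lY lY) => w; ring.
have i13 : itg (fun w => X w * Y w ^+ 3).
  by apply: itg_ext (itg_mul4 lX lY lY lY) => w; ring.
have mp k : measurable_fun setT (fun x : R => x ^+ k) by exact: exprn_measurable.
have mid : measurable_fun setT (fun x : R => x) by exact: measurable_id.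
have e11 : E (fun w => X w * Y w) = 0.
  by rewrite (Ex_indep2_comp mX mY mid mid XY iX iY i11) [E _]X1 mul0r.
have e31 : E (fun w => X w ^+ 3 * Y w) = 0.
  by rewrite (Ex_indep2_comp mX mY (mp 3) mid XY iX3 iY i31) [X in _ * X]Y1 mulr0.
have e13 : E (fun w => X w * Y w ^+ 3) = 0.
  by rewrite (Ex_indep2_comp mX mY mid (mp 3) XY iX iY3 i13) [X in X * _]X1 mul0r.
have e22 : E (fun w => X w ^+ 2 * Y w ^+ 2) = v * u.
  by rewrite (Ex_indep2_comp mX mY (mp 2) (mp 2) XY iX2 iY2 i22) [X in X * _]X2 [X in _ * X]Y2.
split; first exact: L4D.
- by rewrite ExD// X1 Y1 addr0.
- rewrite (_ : E _ = E (fun w => X w ^+ 2 + 2 * (X w * Y w) + Y w ^+ 2)).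
    rewrite ExD ?ExD ?ExZ ?e11 ?X2 ?Y2 ?mulr0 ?addr0//; try exact: itgZ.
    by apply: itgD => //; exact: itgZ.
  by apply: eq_Ex => w; ring.
- rewrite (_ : E _ = E (fun w => X w ^+ 4 + 4 * (X w ^+ 3 * Y w) +
      6 * (X w ^+ 2 * Y w ^+ 2) + 4 * (X w * Y w ^+ 3) + Y w ^+ 4)).
    have j1 := itgD iX4 (itgZ 4 i31); have j2 := itgD j1 (itgZ 6 i22).
    have j3 := itgD j2 (itgZ 4 i13).
    rewrite (ExD j3 iY4) (ExD j2 (itgZ 4 i13)) (ExD j1 (itgZ 6 i22)).
    rewrite (ExD iX4 (itgZ 4 i31)) !ExZ// e31 e22 e13 X4 Y4; ring.
  by apply: eq_Ex => w; ring.
Qed.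

(** Induction on the number of terms: after each addition the partial sum is
    still independent of the remaining variables. *)
Lemma gauss1_sum (I : finType) (eps : I -> {RV P >-> R}) (X : T -> R) v u
    (c : I -> R) :
  gauss1 X v -> (forall i, gauss1 (eps i) u) -> indep_from eps X [set: I]%SET ->
  gauss1 (fun w => X w + \sum_i c i * eps i w) (v + u * \sum_i c i ^+ 2).
Proof.
move=> gX ge hX.
suff h (s : seq I) : uniq s ->
    gauss1 (fun w => X w + \sum_(i <- s) c i * eps i w)
           (v + u * \sum_(i <- s) c i ^+ 2) /\
    indep_from eps (fun w => X w + \sum_(i <- s) c i * eps i w)
      [set i | i \notin s]%SET.
  by have [] := h (index_enum I) (index_enum_uniq I).
elim: s => [_|i s ih /= /andP[nis us]].
  split.
    rewrite big_nil mulr0 addr0 (_ : (fun w => _) = X)//.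
    by apply/funext => w; rewrite big_nil addr0.
  rewrite (_ : [set i | _]%SET = [set: I]%SET); last by apply/setP => i; rewrite !inE.
  by rewrite (_ : (fun w => _) = X)//; apply/funext => w; rewrite big_nil addr0.
have [gs hs] := ih us.
have E1 : (fun w => X w + \sum_(j <- i :: s) c j * eps j w) =
    (fun w => (X w + \sum_(j <- s) c j * eps j w) + c i * eps i w).
  by apply/funext => w; rewrite big_cons; ring.
have [[ms _] _ _ _] := gs.
pose Xs : {RV P >-> R} := mfun_Sub (mem_set ms).
have setE : [set j | j \notin s]%SET = (i |: [set j | j \notin i :: s])%SET.
  apply/setP => j; rewrite !inE negb_or.
  by case: eqP => // ->; rewrite nis.
split.
  rewrite E1 big_cons mulrDr (addrC (u * _)) addrA [u * c i ^+ 2]mulrC.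
  have mc : measurable_fun setT (fun x : R => c i * x) by exact: measurable_funM.
  have h2 : indep2 P (fun w => X w + \sum_(i <- s) c i * eps i w) (eps i).
    by apply: indep_from_indep2 hs; rewrite inE.
  have mid : measurable_fun setT (fun x : R => x) by exact: measurable_id.
  have h3 := indep2_comp mid mc h2.
  exact: gauss1D gs (gauss1Z (c i) (ge i)) h3.
rewrite E1; apply: (@indep_from_add _ _ _ _ _ _ Xs).
  by rewrite !inE eqxx.
by rewrite -setE.
Qed.

End Expectation.

Section GaussianVectors.
Context {R : realType} {d : measure_display} {T : measurableType d}.
Variable P : probability T R.

Local Notation itg X := (P.-integrable setT (EFin \o X)).
Local Notation E := (Ex P).

Definition lin m (a : 'cV[R]_m) (g : T -> 'cV[R]_m) (w : T) : R :=
  (a^T *m g w) 0 0.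

Lemma linD m (a c : 'cV[R]_m) g w : lin (a + c) g w = lin a g w + lin c g w.
Proof. by rewrite /lin linearD/= mulmxDl mxE. Qed.

Lemma linB m (a c : 'cV[R]_m) g w : lin (a - c) g w = lin a g w - lin c g w.
Proof. by rewrite /lin linearB/= mulmxBl !mxE. Qed.

Lemma lin_mulmx m n (F : 'M[R]_(n, m)) (a : 'cV[R]_n) (g : T -> 'cV[R]_m) w :
  lin a (fun w => F *m g w) w = lin (F^T *m a) g w.
Proof. by rewrite /lin trmx_mul trmxK mulmxA. Qed.

Lemma lin_delta m (i : 'I_m) (g : T -> 'cV[R]_m) w :
  lin (delta_mx i 0) g w = g w i 0.
Proof. by rewrite /lin trmx_delta -rowE mxE. Qed.

(** A Gaussian vector as far as moments up to order four can tell; asking for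
    every linear functional makes polarization possible, and covers singular
    covariance matrices. *)
Definition gauss_vec m (g : T -> 'cV[R]_m) (K : 'M[R]_m) : Prop :=
  K^T = K /\ forall a, gauss1 P (lin a g) (quad K a).

Section Isserlis.
Variables (m : nat) (g : T -> 'cV[R]_m) (K : 'M[R]_m).
Hypothesis gK : gauss_vec g K.

Let Ks : K^T = K. Proof. by case: gK. Qed.

Lemma gauss_L4 a : L4 P (lin a g). Proof. by case: gK => _ /(_ a)[]. Qed.

Lemma Ex_lin a : E (lin a g) = 0. Proof. by case: gK => _ /(_ a)[]. Qed.

Lemma Ex_lin_sqr a : E (fun w => lin a g w ^+ 2) = quad K a.
Proof. by case: gK => _ /(_ a)[]. Qed.

Let Ex_lin4 a : E (fun w => lin a g w ^+ 4) = 3 * quad K a ^+ 2.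
Proof. by case: gK => _ /(_ a)[]. Qed.

Let itg22 a c : itg (fun w => lin a g w ^+ 2 * lin c g w ^+ 2).
Proof.
apply: itg_ext (itg_mul4 (gauss_L4 a) (gauss_L4 a) (gauss_L4 c) (gauss_L4 c)).
by move=> w; ring.
Qed.

Let itg211 a b c : itg (fun w => lin a g w ^+ 2 * lin b g w * lin c g w).
Proof.
apply: itg_ext (itg_mul4 (gauss_L4 a) (gauss_L4 a) (gauss_L4 b) (gauss_L4 c)).
by move=> w; ring.
Qed.

Let quadD a c : quad K (a + c) = quad K a + 2 * bil K a c + quad K c.
Proof. by rewrite -[c in LHS]scale1r quadDZ// mulr1 expr1n mul1r. Qed.

Let quadB a c : quad K (a - c) = quad K a - 2 * bil K a c + quad K c.
Proof. by rewrite -scaleN1r quadDZ//; ring. Qed.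

Let bilBl x y z : bil K (x - y) z = bil K x z - bil K y z.
Proof. by rewrite -scaleN1r bilDl bilZl mulN1r. Qed.

Let bilBr x y z : bil K x (y - z) = bil K x y - bil K x z.
Proof. by rewrite -scaleN1r bilDr bilZr mulN1r. Qed.

Lemma Ex_lin2 a c : E (fun w => lin a g w * lin c g w) = bil K a c.
Proof.
have iac := itg_mul2 (gauss_L4 a) (gauss_L4 c).
apply: (@mulfI _ 4) => //; rewrite -ExZ//.
rewrite (_ : E _ = E (fun w => lin (a + c) g w ^+ 2 - lin (a - c) g w ^+ 2)).
  by rewrite ExB ?Ex_lin_sqr ?quadB ?quadD; [ring|exact: itg_sqr (gauss_L4 _)..].
by apply: eq_Ex => w; rewrite linB linD; ring.
Qed.

(* The three identities below polarize [x^4], one variable at a time: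
   [12 x^2 y^2 = (x + y)^4 + (x - y)^4 - 2 x^4 - 2 y^4], then
   [4 y z = (y + z)^2 - (y - z)^2] in the remaining factors. *)
Let Ex_lin22 a c : E (fun w => lin a g w ^+ 2 * lin c g w ^+ 2) =
  quad K a * quad K c + 2 * bil K a c ^+ 2.
Proof.
have i4 x : itg (fun w => lin x g w ^+ 4) by case: (gauss_L4 x).
apply: (@mulfI _ 12) => //; rewrite -ExZ//.
rewrite (_ : E _ = E (fun w => lin (a + c) g w ^+ 4 + lin (a - c) g w ^+ 4
    - 2 * lin a g w ^+ 4 - 2 * lin c g w ^+ 4)).
  have j1 := itgD (i4 (a + c)) (i4 (a - c)).
  have j2 := itgB j1 (itgZ 2 (i4 a)).
  rewrite (ExB j2 (itgZ 2 (i4 c))) (ExB j1 (itgZ 2 (i4 a))) ExD// !ExZ//.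
  by rewrite !Ex_lin4 quadB quadD; ring.
by apply: eq_Ex => w; rewrite linB linD; ring.
Qed.

Let Ex_lin211 a b c : E (fun w => lin a g w ^+ 2 * lin b g w * lin c g w) =
  quad K a * bil K b c + 2 * bil K a b * bil K a c.
Proof.
apply: (@mulfI _ 4) => //; rewrite -ExZ//.
rewrite (_ : E _ = E (fun w => lin a g w ^+ 2 * lin (b + c) g w ^+ 2
    - lin a g w ^+ 2 * lin (b - c) g w ^+ 2)).
  by rewrite ExB// !Ex_lin22 quadB quadD bilBr bilDr; ring.
by apply: eq_Ex => w; rewrite linB linD; ring.
Qed.

(** Isserlis' formula, obtained from the fourth moments by polarization. *)
Lemma Ex_lin4_Isserlis a b c e :
  E (fun w => lin a g w * lin b g w * lin c g w * lin e g w) =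
  bil K a b * bil K c e + bil K a c * bil K b e + bil K a e * bil K b c.
Proof.
have i := itg_mul4 (gauss_L4 a) (gauss_L4 b) (gauss_L4 c) (gauss_L4 e).
apply: (@mulfI _ 4) => //; rewrite -ExZ//.
rewrite (_ : E _ = E (fun w => lin (a + b) g w ^+ 2 * lin c g w * lin e g w
    - lin (a - b) g w ^+ 2 * lin c g w * lin e g w)).
  rewrite ExB// !Ex_lin211 quadB quadD !bilBl !bilDl; ring.
by apply: eq_Ex => w; rewrite linB linD; ring.
Qed.

(** The scalar product of two linear images of the vector: every quadratic
    form of the noise has this shape, and the covariances of the images are
    what the bounds are stated for. *)
Definition dot n (F G : 'M[R]_(n, m)) (w : T) : R :=
  ((F *m g w)^T *m (G *m g w)) 0 0.

Let frow n (F : 'M[R]_(n, m)) k : 'cV[R]_m := F^T *m delta_mx k 0.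

Let frowE n (F : 'M[R]_(n, m)) k w : (F *m g w) k 0 = lin (frow F k) g w.
Proof. by rewrite -lin_mulmx lin_delta. Qed.

Let bil_frow n (F G : 'M[R]_(n, m)) k l :
  bil K (frow F k) (frow G l) = (F *m K *m G^T) k l.
Proof. by rewrite bil_mulmx trmxK /bil trmx_delta -rowE -colE [LHS]mxE [LHS]mxE. Qed.

Let dotE n (F G : 'M[R]_(n, m)) w :
  dot F G w = \sum_k lin (frow F k) g w * lin (frow G k) g w.
Proof. by rewrite /dot mxE; apply: eq_bigr => k _; rewrite mxE !frowE. Qed.

Let cov_tr n (F G : 'M[R]_(n, m)) k l : (F *m K *m G^T) k l = (G *m K *m F^T) l k.
Proof.
by rewrite -[F *m K *m G^T]trmxK [LHS]mxE !trmx_mul trmxK Ks mulmxA.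
Qed.

Lemma dot_itg n (F G : 'M[R]_(n, m)) : itg (dot F G).
Proof.
apply: (itg_ext (fun w => esym (dotE F G w))); apply: itg_sum => k.
by apply: itg_mul2; exact: gauss_L4.
Qed.

Let dot_sqrE n (F G : 'M[R]_(n, m)) w : dot F G w ^+ 2 =
  \sum_k \sum_l lin (frow F k) g w * lin (frow G k) g w *
    lin (frow F l) g w * lin (frow G l) g w.
Proof.
rewrite dotE expr2 mulr_suml; apply: eq_bigr => k _.
by rewrite mulr_sumr; apply: eq_bigr => l _; rewrite mulrA.
Qed.

Lemma dot_sqr_itg n (F G : 'M[R]_(n, m)) : itg (fun w => dot F G w ^+ 2).
Proof.
apply: (itg_ext (fun w => esym (dot_sqrE F G w))).
by do 2 (apply: itg_sum => ?); apply: itg_mul4; exact: gauss_L4.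
Qed.

Lemma Ex_dot n (F G : 'M[R]_(n, m)) : E (dot F G) = \tr (F *m K *m G^T).
Proof.
rewrite (eq_Ex P (dotE F G)) Ex_sum.
  by apply: eq_bigr => k _; rewrite Ex_lin2 bil_frow.
by move=> k; apply: itg_mul2; exact: gauss_L4.
Qed.

(** The three pairings of Isserlis' formula, summed over the coordinates. *)
Lemma Ex_dot_sqr n (F G : 'M[R]_(n, m)) :
  E (fun w => dot F G w ^+ 2) = (\tr (F *m K *m G^T)) ^+ 2 +
    \tr ((F *m K *m F^T) *m (G *m K *m G^T)) +
    \tr ((F *m K *m G^T) *m (F *m K *m G^T)).
Proof.
have i k l : itg (fun w => lin (frow F k) g w * lin (frow G k) g w *
    lin (frow F l) g w * lin (frow G l) g w).
  by apply: itg_mul4; exact: gauss_L4.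
rewrite (eq_Ex P (dot_sqrE F G)) Ex_sum; last by move=> k; apply: itg_sum.
under eq_bigr => k _ do rewrite Ex_sum//.
under eq_bigr => k _ do under eq_bigr => l _ do
  rewrite Ex_lin4_Isserlis !bil_frow.
rewrite expr2 [X in X * _]/mxtrace mulr_suml -!big_split /=.
apply: eq_bigr => k _.
rewrite [X in _ + X + _]mxE [X in _ + X]mxE mulr_sumr -!big_split /=.
apply: eq_bigr => l _.
by congr (_ + _ * _ + _ * _); exact: cov_tr.
Qed.

End Isserlis.
End GaussianVectors.

(** * The noise of the mixed-effect model *)

Section Model.
Context {R : realType} {d : measure_display} {T : measurableType d}.
Variable P : probability T R.
Variables (n p : nat).
Variables (b : 'I_p -> {RV P >-> R}) (eps : 'I_n -> {RV P >-> R}).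
Variables (B : 'M[R]_p) (sigma : R).
Hypothesis B_psd : psdmx B.
Hypothesis b_normal : is_mvnormal b 0 B.
Hypothesis eps_normal : forall i, has_normal_law P (eps i) 0 (sigma ^+ 2).
Hypothesis eps_b_indep : mutually_independent P (model_sigma eps b).

Definition noise (w : T) : 'cV[R]_(p + n) := col_mx (rvec b w) (rvec eps w).

Definition noise_cov : 'M[R]_(p + n) := block_mx B 0 0 (sigma ^+ 2)%:M.

Lemma linear_effectE (a : 'cV[R]_p) w :
  (a^T *m rvec b w) 0 0 = \sum_j a j 0 * b j w.
Proof. by rewrite mxE; apply: eq_bigr => j _; rewrite !mxE. Qed.

(** The independence hypothesis concerns the sigma-algebra generated by [b];
    this makes it applicable to the linear functionals of [b]. *)
Lemma linear_effect_sigma (a : 'cV[R]_p) (A : set R) : measurable A ->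
  g_sigma_preimage (fun j => b j : T -> R)
    ((fun w => (a^T *m rvec b w) 0 0) @^-1` A).
Proof.
move=> mA; pose G := \big[setU/set0]_(i < p)
  preimage_set_system setT (b i : T -> R) measurable.
have mb j : @measurable_fun _ _ (g_sigma_algebraType G) R setT (b j).
  move=> _ C mC; apply: sub_sigma_algebra; rewrite /G (bigD1 j)//=; left.
  by exists C.
have mX : @measurable_fun _ _ (g_sigma_algebraType G) R setT
    (fun w => \sum_j a j 0 * b j w).
  by apply: measurable_sum => j; apply: measurable_funM => //; exact: measurable_cst.
have := mX measurableT A mA; rewrite setTI.
rewrite (_ : _ @^-1` A = (fun w => (a^T *m rvec b w) 0 0) @^-1` A)//.
by congr (_ @^-1` A); apply/funext => w; rewrite linear_effectE.
Qed.

Lemma linear_effect_indep (a : 'cV[R]_p) :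
  indep_from eps (fun w => (a^T *m rvec b w) 0 0) [set: 'I_n]%SET.
Proof.
move=> A C mA mC.
pose F (k : option 'I_n) : set T := if k is Some i then eps i @^-1` C i
  else (fun w => (a^T *m rvec b w) 0 0) @^-1` A.
have := @eps_b_indep [set: option 'I_n]%SET F _.
rewrite (bigD1 None) ?inE//= (reindex_omap Some id)/=; last by case=> [i|] /andP[].
rewrite (_ : \bigcap_(i in [set` [set: option 'I_n]%SET]) F i = F None `&` joint eps [set: 'I_n]%SET C); last first.
  apply/seteqP; split=> w /= => [h|[h1 h2] [i|] _ //].
    by split=> [|i _]; [exact: (h None (finset.in_setT _))|exact: (h (Some i) (finset.in_setT _))].
  by apply: h2; exact: finset.in_setT.
move=> -> => [|[i|] _].
- by congr (_ * _)%E; apply: eq_bigl => i; rewrite !inE eqxx.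
- by exists (C i) => //; rewrite setTI.
- exact: linear_effect_sigma.
Qed.

(** A functional of [(b, eps)] is a functional of [b], which is normal by
    hypothesis, plus a linear combination of the independent [eps i]. *)
Lemma noise_gauss_vec : gauss_vec P noise noise_cov.
Proof.
split=> [|a].
  by rewrite tr_block_mx !trmx0 tr_scalar_mx (psdmx_sym B_psd).
rewrite quad_block_diag quad_scalar normsqE.
rewrite (_ : lin a noise = fun w => ((usubmx a)^T *m rvec b w) 0 0 +
    \sum_i dsubmx a i 0 * eps i w); last first.
  apply/funext => w; rewrite /lin /noise -{1}[a]vsubmxK tr_col_mx mul_row_col mxE.
  by congr (_ + _); rewrite mxE; apply: eq_bigr => i _; rewrite !mxE.
apply: gauss1_sum; last exact: linear_effect_indep.
  have mX : measurable_fun setT (fun w => ((usubmx a)^T *m rvec b w) 0 0).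
    rewrite (_ : (fun w => _) = fun w => \sum_j usubmx a j 0 * b j w).
      by apply: measurable_sum => j; apply: measurable_funM.
    by apply/funext => w; rewrite linear_effectE.
  pose X : {RV P >-> R} := mfun_Sub (mem_set mX).
  apply: (@gauss1_normal _ _ _ _ X); first exact: psd_quad_ge0.
  by have := b_normal (usubmx a); rewrite mulmx0 mxE.
by move=> i; apply: gauss1_normal; [exact: sqr_ge0|exact: eps_normal].
Qed.

End Model.

(** * Risk bounds at a fixed sample size *)

Section Operator.
Context {R : realType}.

Lemma normsqD n (x y : 'cV[R]_n) :
  normsq (x + y) = normsq x + 2 * (x^T *m y) 0 0 + normsq y.
Proof.
have := quadDZ x y 1 (trmx1 _ _ : (1%:M : 'M[R]_n)^T = 1%:M).
by rewrite !quad_scalar /bil mulmx1 scale1r !mul1r mulr1 expr1n mul1r.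
Qed.

Lemma tr_1B n (A : 'M[R]_n) : A^T = A -> (1%:M - A)^T = 1%:M - A.
Proof. by move=> sA; rewrite linearB/= trmx1 sA. Qed.

(** [|G^T x|^2] is the scalar product of [G (G^T x)] and [x], so that the
    Cauchy-Schwarz inequality bounds it by [sqrt C |G^T x| |x|]. *)
Lemma normsq_tr_le m n (G : 'M[R]_(n, m)) C : 0 <= C ->
  (forall v, normsq (G *m v) <= C * normsq v) ->
  forall x, normsq (G^T *m x) <= C * normsq x.
Proof.
move=> C0 h x; set y := G^T *m x.
have [y0|y0] := eqVneq (normsq y) 0.
  by rewrite y0 mulr_ge0// normsq_ge0.
have y1 : 0 < normsq y by rewrite lt_def y0 normsq_ge0.
have p1 : psdmx (1%:M : 'M[R]_n).
  by apply: psdmxI => [|z]; rewrite ?trmx1// quad_scalar mul1r normsq_ge0.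
have := psd_CauchySchwarz (G *m y) x p1; rewrite !quad_scalar !mul1r.
have -> : bil 1%:M (G *m y) x = normsq y.
  by rewrite /bil mulmx1 trmx_mul -mulmxA.
move=> /le_trans/(_ (ler_wpM2r (normsq_ge0 x) (h y))).
by rewrite expr2 mulrAC ler_pM2r.
Qed.

End Operator.

Section SquareIntegrable.
Context {R : realType} {d : measure_display} {T : measurableType d}.
Variable P : probability T R.

Local Notation itg X := (P.-integrable setT (EFin \o X)).
Local Notation E := (Ex P).

Definition sqint (X : T -> R) : Prop :=
  measurable_fun setT X /\ itg (fun w => X w ^+ 2).

Lemma itg_measurable (X : T -> R) : itg X -> measurable_fun setT X.
Proof. by move=> /measurable_int/measurable_EFinP. Qed.

Lemma sqint_itg X : sqint X -> itg X.
Proof.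
move=> [mX iX]; apply: itg_le mX (itgD (itg_cst P 1) iX) _ => w.
by have := real_normK (num_real (X w)); have := sqr_ge0 (`|X w| - 1); nra.
Qed.

Lemma sqint_cst c : sqint (fun=> c).
Proof. by split; [exact: measurable_cst|exact: itg_cst]. Qed.

Lemma sqintZ c X : sqint X -> sqint (fun w => c * X w).
Proof.
move=> [mX iX]; split; first exact: measurable_funM.
by apply: itg_ext (itgZ (c ^+ 2) iX) => w; rewrite exprMn.
Qed.

Lemma sqrD_le (x y : R) : (x + y) ^+ 2 <= 2 * x ^+ 2 + 2 * y ^+ 2.
Proof. have := sqr_ge0 (x - y); nra. Qed.

Lemma sqintD X Y : sqint X -> sqint Y -> sqint (fun w => X w + Y w).
Proof.
move=> [mX iX] [mY iY]; have mXY := measurable_funD mX mY.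
split=> //; apply: itg_le _ (itgD (itgZ 2 iX) (itgZ 2 iY)) _ => [|w].
  exact: measurable_funX.
by rewrite ger0_norm ?sqr_ge0// sqrD_le.
Qed.

Lemma Ex_sqrD_le X Y : sqint X -> sqint Y ->
  E (fun w => (X w + Y w) ^+ 2) <=
  2 * E (fun w => X w ^+ 2) + 2 * E (fun w => Y w ^+ 2).
Proof.
move=> hX hY; have [_ iXY] := sqintD hX hY; case: hX => _ iX; case: hY => _ iY.
rewrite -!ExZ// -ExD; [|exact: itgZ..].
apply: le_Ex => // [|w]; last exact: sqrD_le.
by apply: itgD; exact: itgZ.
Qed.

Section GaussSquareIntegrable.
Variables (m : nat) (g : T -> 'cV[R]_m) (K : 'M[R]_m).
Hypothesis gK : gauss_vec P g K.

Lemma lin_sqint a : sqint (lin a g).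
Proof.
by split; [have [] := gauss_L4 gK a|exact: itg_sqr (gauss_L4 gK a)].
Qed.

Lemma dot_sqint n (F G : 'M[R]_(n, m)) : sqint (dot g F G).
Proof.
by split; [exact: itg_measurable (dot_itg gK F G)|exact: (dot_sqr_itg gK)].
Qed.

Lemma var_dot n (F G : 'M[R]_(n, m)) :
  E (fun w => (dot g F G w - \tr (F *m K *m G^T)) ^+ 2) =
  \tr ((F *m K *m F^T) *m (G *m K *m G^T)) +
  \tr ((F *m K *m G^T) *m (F *m K *m G^T)).
Proof.
set t := \tr (F *m K *m G^T).
rewrite (_ : E _ = E (fun w => dot g F G w ^+ 2 - 2 * t * dot g F G w + t ^+ 2)).
  have i1 := dot_sqr_itg gK F G; have i2 := dot_itg gK F G.
  rewrite (ExD (itgB i1 (itgZ (2 * t) i2)) (itg_cst P (t ^+ 2))).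
  rewrite (ExB i1 (itgZ (2 * t) i2)) (ExZ (2 * t) i2) Ex_cst.
  by rewrite (Ex_dot_sqr gK) (Ex_dot gK) -/t; ring.
by apply: eq_Ex => w; ring.
Qed.

End GaussSquareIntegrable.
End SquareIntegrable.

Section FixedDesign.
Context {R : realType} {n p q : nat}.
Variables (Rm : 'M[R]_(n, q)) (Z : 'M[R]_(n, p)) (Q : 'M[R]_q).
Variables (lambda : R) (Sigma B : 'M[R]_p) (sigma : R) (eta : 'cV[R]_n).
Hypothesis Q_psd : psdmx Q.
Hypothesis lambda_ge0 : 0 <= lambda.
Hypothesis Sigma_pd : pdmx Sigma.

Let A := smooth_mx Rm Z Q lambda Sigma.
Let PZ := proj_range Z.

Lemma penalty_psd : psdmx ((n%:R * lambda) *: Q).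
Proof. by apply: psd_scale => //; rewrite mulr_ge0. Qed.

Lemma smooth_mxE : A =
  ridge (row_mx Rm Z) (block_mx ((n%:R * lambda) *: Q) 0 0 Sigma).
Proof.
rewrite /A /smooth_mx /ridge tr_row_mx; congr (_ *m mpinv _ *m _).
by rewrite mul_col_row add_block_mx !addr0.
Qed.

Lemma block_penalty_psd : psdmx (block_mx ((n%:R * lambda) *: Q) 0 0 Sigma).
Proof. exact: mixed_psd penalty_psd Sigma_pd. Qed.

Lemma proj_rangeE : PZ = ridge Z 0.
Proof. by rewrite /ridge addr0. Qed.

Lemma Y_hatE Y : Y_hat Rm Z Q lambda Sigma Y = A *m Y.
Proof.
rewrite /Y_hat /c_hat /b_hat -mul_row_col vsubmxK /coef_hat /A /smooth_mx.
by rewrite -mul_col_mx !mulmxA.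
Qed.

Definition fit_error (beta : 'cV[R]_p) (e : 'cV[R]_n) : 'cV[R]_n :=
  A *m (eta + Z *m beta + e) - eta - Z *m beta.

Lemma loss1E beta e : loss1 Rm Z Q lambda Sigma eta beta (eta + Z *m beta + e) =
  n%:R^-1 * normsq (fit_error beta e).
Proof.
rewrite /loss1 normsqE Y_hatE; congr (_ * _); apply: eq_bigr => i _.
by rewrite !mxE.
Qed.

Lemma normsq_proj x : normsq ((1%:M - PZ) *m x) = normsq x - normsq (PZ *m x).
Proof.
rewrite proj_rangeE normsq_1B_ridge; last exact: psd0.
rewrite [in RHS]normsq_mulmx [in LHS]normsq_mulmx.
rewrite (ridge_sym Z (psd0 _)) ridge0_idem; ring.
Qed.

(** The complementary projection annihilates [Z (b_hat - b)], the part of the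
    fit error that is missing from the error of [eta_hat]. *)
Lemma loss2E beta e : loss2 Rm Z Q lambda Sigma eta (eta + Z *m beta + e) =
  n%:R^-1 * normsq ((1%:M - PZ) *m fit_error beta e).
Proof.
have sP := ridge_sym Z (psd0 p); have iP := ridge0_idem Z.
have fP : ridge Z 0 *m Z = Z := ridge0_fix Z.
rewrite /loss2 -/PZ; congr (_ * _); set Y := eta + _ + _.
have -> : (1%:M - PZ) *m fit_error beta e =
    (1%:M - PZ) *m (eta_hat Rm Z Q lambda Sigma Y - eta).
  have -> : fit_error beta e = eta_hat Rm Z Q lambda Sigma Y - eta +
      Z *m (b_hat Rm Z Q lambda Sigma Y - beta).
    rewrite /fit_error -/Y -Y_hatE /Y_hat /eta_hat mulmxBr.
    by rewrite addrA; congr (_ - _); rewrite addrAC.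
  have PZ0 : (1%:M - PZ) *m Z = 0.
    by rewrite mulmxBl mul1mx proj_rangeE fP subrr.
  by rewrite mulmxDr mulmxA PZ0 mul0mx addr0.
rewrite normsq_mulmx; congr (quad _ _).
rewrite proj_rangeE (tr_1B sP) mulmxBl !mulmxBr !mul1mx mulmx1 iP.
by rewrite subrr subr0.
Qed.

(** The residual [(1 - A) Y] is [e] minus the fit error. *)
Lemma score_U_E beta e : let Y := eta + Z *m beta + e in
  quad ((1%:M - A) *m (1%:M - A)) Y =
  normsq (fit_error beta e) - 2 * ((fit_error beta e)^T *m e) 0 0 + normsq e.
Proof.
move=> Y; have sA : A^T = A by rewrite smooth_mxE; exact: ridge_sym block_penalty_psd.
have -> : (1%:M - A) *m (1%:M - A) = (1%:M - A)^T *m (1%:M - A).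
  by rewrite (tr_1B sA).
rewrite -normsq_mulmx.
have -> : (1%:M - A) *m Y = e + - fit_error beta e.
  rewrite mulmxBl mul1mx /fit_error -/Y; move: (A *m Y) => V.
  rewrite !opprB !addrA; congr (_ - _).
  by rewrite /Y [RHS]addrC [e + _]addrC addrA.
rewrite normsqD normsqN mulmxN mxE.
have -> : (e^T *m fit_error beta e) 0 0 = ((fit_error beta e)^T *m e) 0 0.
  by rewrite !mxE; apply: eq_bigr => i _; rewrite !mxE mulrC.
ring.
Qed.

Context {d : measure_display} {T : measurableType d}.
Variable P : probability T R.
Variables (b : 'I_p -> {RV P >-> R}) (eps : 'I_n -> {RV P >-> R}).
Let K := noise_cov n B sigma.
Hypothesis B_psd : psdmx B.
Hypothesis gK : gauss_vec P (noise b eps) K.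

Local Notation itg X := (P.-integrable setT (EFin \o X)).
Local Notation E := (Ex P).
Let g := noise b eps.

Let sA : A^T = A.
Proof. by rewrite smooth_mxE; exact: ridge_sym block_penalty_psd. Qed.

Definition error_bias : 'cV[R]_n := (A - 1%:M) *m eta.
Definition error_map : 'M[R]_(n, p + n) := row_mx ((A - 1%:M) *m Z) A.
Definition eps_map : 'M[R]_(n, p + n) := row_mx 0 1%:M.
Let m0 := error_bias.
Let Fr := error_map.
Let Fe := eps_map.
Let Kr := Fr *m K *m Fr^T.

Let fe w := fit_error (rvec b w) (rvec eps w).

Lemma fit_errorE w : fe w = m0 + Fr *m g w.
Proof.
rewrite /fe /fit_error /m0 /error_bias /Fr /g /noise mul_row_col.
rewrite -[(A - 1%:M) *m Z *m _]mulmxA !mulmxBl !mul1mx !mulmxDr -!addrA.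
congr (_ + _); rewrite [RHS]addrCA; congr (_ + _).
by rewrite addrC -addrA.
Qed.

Lemma eps_mapE w : Fe *m g w = rvec eps w.
Proof. by rewrite /Fe /g /noise mul_row_col mul0mx mul1mx add0r. Qed.

Lemma error_covE : Kr = ((A - 1%:M) *m Z) *m B *m ((A - 1%:M) *m Z)^T +
  sigma ^+ 2 *: (A *m A).
Proof.
rewrite /Kr /Fr /K /noise_cov mul_row_block !mulmx0 addr0 add0r tr_row_mx.
by rewrite mul_row_col mul_mx_scalar -scalemxAl sA.
Qed.

Lemma error_eps_covE : Fr *m K *m Fe^T = sigma ^+ 2 *: A.
Proof.
rewrite /Fr /K /noise_cov mul_row_block !mulmx0 addr0 add0r tr_row_mx.
by rewrite mul_row_col trmx0 mulmx0 trmx1 mulmx1 add0r mul_mx_scalar.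
Qed.

Lemma eps_covE : Fe *m K *m Fe^T = (sigma ^+ 2)%:M.
Proof.
rewrite /Fe /K /noise_cov mul_row_block !mul0mx !mulmx0 !add0r mul1mx.
by rewrite tr_row_mx mul_row_col mul0mx trmx1 mulmx1 add0r.
Qed.

Lemma error_cov_psd : psdmx Kr.
Proof.
rewrite /Kr -{1}[Fr]trmxK; apply: psd_congr; apply: psd_block_diag => //.
apply: psdmxI => [|y]; first by rewrite tr_scalar_mx.
by rewrite quad_scalar mulr_ge0 ?sqr_ge0 ?normsq_ge0.
Qed.

(** [n] times the expectation of [loss1]: squared bias plus variance. *)
Definition risk : R := normsq m0 + \tr Kr.

Lemma tr_sqr_le_risk : sigma ^+ 2 * \tr (A *m A) <= \tr Kr.
Proof.
rewrite error_covE mxtraceD mxtraceZ lerDr.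
apply: psd_tr_ge0; rewrite -{1}[_ *m Z]trmxK; exact: psd_congr.
Qed.

Lemma trKr_ge0 : 0 <= \tr Kr. Proof. exact: psd_tr_ge0 error_cov_psd. Qed.

Let S w := normsq (fe w).

Lemma normsq_errorE w :
  S w = normsq m0 + 2 * lin (Fr^T *m m0) g w + dot g Fr Fr w.
Proof. by rewrite /S fit_errorE normsqD /lin [(Fr^T *m m0)^T]trmx_mul trmxK mulmxA. Qed.

Lemma normsq_error_sqint : sqint P S.
Proof.
rewrite (funext normsq_errorE).
apply: sqintD; last exact: (dot_sqint gK).
by apply: sqintD; [exact: sqint_cst|apply: sqintZ; exact: (lin_sqint gK)].
Qed.

Lemma normsq_mul_error_sqint (M : 'M[R]_n) :
  sqint P (fun w => normsq (M *m fe w)).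
Proof.
rewrite (_ : (fun w => _) = fun w => normsq (M *m m0) +
    2 * lin ((M *m Fr)^T *m (M *m m0)) g w + dot g (M *m Fr) (M *m Fr) w).
  apply: sqintD; last exact: (dot_sqint gK).
  by apply: sqintD; [exact: sqint_cst|apply: sqintZ; exact: (lin_sqint gK)].
apply/funext => w; rewrite fit_errorE mulmxDr normsqD /lin.
by rewrite [((M *m Fr)^T *m _)^T]trmx_mul trmxK /dot -!mulmxA.
Qed.

Lemma Ex_normsq_error : E S = risk.
Proof.
have i1 := sqint_itg (lin_sqint gK (Fr^T *m m0)); have i2 := dot_itg gK Fr Fr.
rewrite (eq_Ex P normsq_errorE).
rewrite (ExD (itgD (itg_cst P _) (itgZ 2 i1)) i2) (ExD (itg_cst P _) (itgZ 2 i1)).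
by rewrite (ExZ 2 i1) Ex_cst (Ex_lin gK) (Ex_dot gK) mulr0 addr0.
Qed.

Section Bounds.
Variables (CB C1 : R).
Hypotheses (CB0 : 0 <= CB) (C10 : 0 <= C1).
Hypothesis B_le : forall y, quad B y <= CB * normsq y.
Hypothesis ranef_le : forall v, normsq ((1%:M - A) *m (Z *m v)) <= C1 * normsq v.

Let Cr := CB * C1 + sigma ^+ 2.

(** The two terms of the covariance come from [b] and from [eps]; the first is
    bounded through the transpose of [(1 - A) Z], the second by [A^2 <= 1]. *)
Lemma quad_error_cov_le x : quad Kr x <= Cr * normsq x.
Proof.
rewrite error_covE -[quad _ _]/(bil _ _ _) bilD /Cr mulrDl lerD//.
  rewrite -[bil _ _ _]/(quad _ _) -{1}[_ *m Z]trmxK -quad_mulmx.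
  apply: (le_trans (B_le _)); rewrite -mulrA ler_wpM2l//.
  apply: normsq_tr_le => // v.
  by rewrite -mulmxA -[A - _]opprB mulNmx normsqN.
rewrite /bil -scalemxAr -scalemxAl mxE ler_wpM2l ?sqr_ge0//.
rewrite -{1}sA -/(quad _ _) -normsq_mulmx smooth_mxE.
exact: normsq_ridge_le block_penalty_psd _.
Qed.

(** With [m0] the bias and [Kr] the covariance of the fit error, the linear
    part has variance [4 quad Kr m0] and the quadratic part [2 tr (Kr^2)]; both
    are controlled by the largest eigenvalue of [Kr] times the risk. *)
Lemma var_normsq_error : E (fun w => (S w - risk) ^+ 2) <= 8 * Cr * risk.
Proof.
pose X w := 2 * lin (Fr^T *m m0) g w; pose Y w := dot g Fr Fr w + - \tr Kr.
have hX : sqint P X by apply: sqintZ; exact: (lin_sqint gK).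
have hY : sqint P Y by apply: sqintD; [exact: (dot_sqint gK)|exact: sqint_cst].
rewrite (_ : E _ = E (fun w => (X w + Y w) ^+ 2)); last first.
  by apply: eq_Ex => w; rewrite normsq_errorE /risk /X /Y; ring.
apply: (le_trans (Ex_sqrD_le hX hY)).
have -> : E (fun w => X w ^+ 2) = 4 * quad Kr m0.
  rewrite (_ : E _ = E (fun w => 4 * lin (Fr^T *m m0) g w ^+ 2)).
    rewrite ExZ; last by have [] := lin_sqint gK (Fr^T *m m0).
    by rewrite (Ex_lin_sqr gK) quad_mulmx trmxK.
  by apply: eq_Ex => w; rewrite /X; ring.
have -> : E (fun w => Y w ^+ 2) = 2 * \tr (Kr *m Kr).
  by rewrite (var_dot gK) -/Kr; ring.
have h1 := quad_error_cov_le m0.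
have h2 := psd_tr_sqr_le error_cov_psd quad_error_cov_le.
have Cr0 : 0 <= Cr by rewrite /Cr addr_ge0 ?sqr_ge0// mulr_ge0.
have h3 : 0 <= Cr * \tr Kr by rewrite mulr_ge0// trKr_ge0.
by rewrite /risk mulrDr; lra.
Qed.

End Bounds.

(** [n] times the deviation of [score_U] from [loss1 + |eps|^2 / n]. *)
Definition score_error w : R :=
  quad ((1%:M - A) *m (1%:M - A)) (eta + Z *m rvec b w + rvec eps w)
  + 2 * sigma ^+ 2 * \tr A - S w - normsq (rvec eps w).

(** The term [2 sigma^2 tr A] centers the bilinear form in the fit error and
    [eps], since their cross-covariance is [sigma^2 A]. *)
Lemma score_errorE w : score_error w =
  -2 * (lin (Fe^T *m m0) g w + (dot g Fr Fe w + - (sigma ^+ 2 * \tr A))).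
Proof.
rewrite /score_error score_U_E -/(fe w) -/(S w) fit_errorE.
have -> : ((m0 + Fr *m g w)^T *m rvec eps w) 0 0 =
    lin (Fe^T *m m0) g w + dot g Fr Fe w.
  rewrite linearD/= mulmxDl mxE -eps_mapE; congr (_ + _).
  by rewrite /lin [(Fe^T *m m0)^T]trmx_mul trmxK mulmxA.
ring.
Qed.

Lemma score_error_sqint : sqint P score_error.
Proof.
rewrite (funext score_errorE).
apply: sqintZ; apply: sqintD; first exact: (lin_sqint gK).
by apply: sqintD; [exact: (dot_sqint gK)|exact: sqint_cst].
Qed.

Lemma var_score_error :
  E (fun w => score_error w ^+ 2) <= 16 * sigma ^+ 2 * risk.
Proof.
pose X w := lin (Fe^T *m m0) g w.
pose Y w := dot g Fr Fe w + - (sigma ^+ 2 * \tr A).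
have hX : sqint P X by exact: (lin_sqint gK).
have hY : sqint P Y by apply: sqintD; [exact: (dot_sqint gK)|exact: sqint_cst].
have [_ iXY] := sqintD hX hY.
rewrite (_ : E _ = E (fun w => 4 * (X w + Y w) ^+ 2)); last first.
  by apply: eq_Ex => w; rewrite score_errorE /X /Y; ring.
rewrite ExZ//; have := Ex_sqrD_le hX hY.
have -> : E (fun w => X w ^+ 2) = sigma ^+ 2 * normsq m0.
  by rewrite (Ex_lin_sqr gK) quad_mulmx trmxK eps_covE quad_scalar.
have -> : E (fun w => Y w ^+ 2) =
    sigma ^+ 2 * \tr Kr + sigma ^+ 2 * (sigma ^+ 2 * \tr (A *m A)).
  have := var_dot gK Fr Fe; rewrite error_eps_covE eps_covE -/Kr mxtraceZ => ->.
  rewrite mul_mx_scalar mxtraceZ; congr (_ + _).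
  by rewrite -scalemxAl -scalemxAr !mxtraceZ.
have s0 := sqr_ge0 sigma.
have h1 := ler_wpM2l s0 tr_sqr_le_risk.
have h2 := mulr_ge0 s0 (normsq_ge0 m0).
by rewrite /risk => h3; nra.
Qed.

Lemma eps_sqr_sqint : sqint P (fun w => normsq (rvec eps w) - n%:R * sigma ^+ 2).
Proof.
apply: sqintD; last exact: sqint_cst.
rewrite (_ : (fun w => _) = dot g Fe Fe); first exact: (dot_sqint gK).
by apply/funext => w; rewrite /dot eps_mapE.
Qed.

Lemma var_eps_sqr :
  E (fun w => (normsq (rvec eps w) - n%:R * sigma ^+ 2) ^+ 2) =
  2 * n%:R * sigma ^+ 4.
Proof.
have := var_dot gK Fe Fe; rewrite eps_covE mxtrace_scalar -scalar_mxM.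
rewrite !mxtrace_scalar => h.
rewrite (_ : E _ = E (fun w => (dot g Fe Fe w - sigma ^+ 2 *+ n) ^+ 2)).
  by rewrite h; ring.
by apply: eq_Ex => w; rewrite /dot eps_mapE /normsq; ring.
Qed.

End FixedDesign.

(** * Convergence in probability relative to a deterministic scale *)

Section Deviation.
Context {R : realType} {d : measure_display} {T : measurableType d}.
Variable P : probability T R.

Local Notation itg X := (P.-integrable setT (EFin \o X)).

Lemma measurable_ge_set (X : T -> R) c : measurable_fun setT X ->
  measurable [set w | c <= X w].
Proof.
move=> mX; rewrite (_ : [set w | _] = X @^-1` `[c, +oo[).
  by rewrite -[X in measurable X]setTI; exact: mX.
by apply/seteqP; split=> w /=; rewrite in_itv/= andbT.
Qed.

Lemma probability_ge_le (X : T -> R) c : (forall w, 0 <= X w) -> itg X -> 0 < c ->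
  (P [set w | (c <= X w)%R] <= (Ex P X / c)%:E)%E.
Proof.
move=> X0 iX c0; set S := [set w | _].
have mS : measurable S by apply: measurable_ge_set; exact: itg_measurable iX.
have iS : itg (\1_S : T -> R) by exact: integrable_indic.
have ES : ((Ex P (\1_S : T -> R))%:E = P S)%E.
  by rewrite /Ex /Rintegral integral_indic// setIT fineK// fin_num_measure.
rewrite -ES lee_fin ler_pdivlMr// mulrC -ExZ//.
apply: le_Ex => // [|w]; first exact: itgZ.
rewrite indicE; case: (boolP (w \in S)) => [/[!inE] wS|_]; last by rewrite mulr0.
by rewrite mulr1.
Qed.

Lemma chebyshev_le (X : T -> R) c : sqint P X -> 0 < c ->
  (P [set w | (c <= `|X w|)%R] <= (Ex P (fun w => X w ^+ 2)%R / c ^+ 2)%:E)%E.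
Proof.
move=> [_ iX] c0.
rewrite (_ : [set w | _] = [set w | c ^+ 2 <= X w ^+ 2]).
  by apply: probability_ge_le; [move=> w; exact: sqr_ge0|exact: iX|exact: exprn_gt0].
apply/seteqP; split=> w /=; rewrite -(real_normK (num_real (X w))) ler_pXn2r//.
- by rewrite nnegrE ltW.
- by rewrite nnegrE ltW.
Qed.

End Deviation.

Section Small.
Context {R : realType} {d : nat -> measure_display}.
Context {T : forall n, measurableType (d n)}.
Variables (P : forall n, probability (T n) R) (rho : nat -> R).
Hypothesis n_rho : forall A : R, \forall n \near \oo, A <= n%:R * rho n.

(** [X] is [o_p(rho)].  Phrasing the event with [delta * rho n] instead of a
    quotient avoids any case distinction on the values of [rho]. *)
Definition small (X : forall n, T n -> R) : Prop :=
  forall delta gamma : R, 0 < delta -> 0 < gamma -> \forall n \near \oo,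
  (P n [set w | (delta * rho n <= `|X n w|)%R] <= gamma%:E)%E.

Lemma near_rho_gt0 : \forall n \near \oo, 0 < rho n.
Proof.
near=> n; have : 1 <= n%:R * rho n by near: n; exact: n_rho.
move=> h; have : 0 < n%:R * rho n by exact: lt_le_trans h.
rewrite pmulr_rgt0// ltr0n; by near: n; exists 1%N.
Unshelve. all: by end_near. Qed.

Let msmall n (X : T n -> R) c : measurable_fun setT X ->
  measurable [set w | c <= `|X w|].
Proof.
by move=> mX; apply: (measurable_ge_set (X := fun w => `|X w|)); exact: measurableT_comp.
Qed.

Lemma small_sub (X Y : forall n, T n -> R) :
  (forall n, measurable_fun setT (X n)) -> (forall n, measurable_fun setT (Y n)) ->
  (\forall n \near \oo, forall w, `|X n w| <= `|Y n w|) -> small Y -> small X.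
Proof.
move=> mX mY XY sY delta gamma d0 g0; near=> n.
have h1 : forall w, `|X n w| <= `|Y n w| by near: n.
have h2 : (P n [set w | (delta * rho n <= `|Y n w|)%R] <= gamma%:E)%E.
  by near: n; exact: sY.
apply: le_trans h2; apply: le_measure; rewrite ?inE; [exact: msmall..|].
by move=> w /= h; exact: le_trans h (h1 w).
Unshelve. all: by end_near. Qed.

Lemma smallD (X Y : forall n, T n -> R) :
  (forall n, measurable_fun setT (X n)) -> (forall n, measurable_fun setT (Y n)) ->
  small X -> small Y -> small (fun n w => X n w + Y n w).
Proof.
move=> mX mY sX sY delta gamma d0 g0; near=> n.
have h1 : (P n [set w | (delta / 2 * rho n <= `|X n w|)%R] <= (gamma / 2)%:E)%E.
  by near: n; apply: sX; rewrite divr_gt0.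
have h2 : (P n [set w | (delta / 2 * rho n <= `|Y n w|)%R] <= (gamma / 2)%:E)%E.
  by near: n; apply: sY; rewrite divr_gt0.
rewrite [gamma]splitr EFinD; apply: le_trans (leeD h1 h2).
apply: le_trans (measureU2 (P n) _ _); [|exact: msmall..].
apply: le_measure; rewrite ?inE.
- by apply: msmall; exact: measurable_funD.
- by apply: measurableU; exact: msmall.
move=> w /= h; have := le_trans h (ler_normD _ _).
have [|h3] := leP (delta / 2 * rho n) `|X n w|; first by left.
by move=> h4; right; lra.
Unshelve. all: by end_near. Qed.

Lemma smallZ (c : nat -> R) (M : R) (X : forall n, T n -> R) : 0 < M ->
  (\forall n \near \oo, `|c n| <= M) -> (forall n, measurable_fun setT (X n)) ->
  small X -> small (fun n w => c n * X n w).
Proof.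
move=> M0 cM mX sX delta gamma d0 g0; near=> n.
have h1 : `|c n| <= M by near: n.
have h2 : (P n [set w | (delta / M * rho n <= `|X n w|)%R] <= gamma%:E)%E.
  by near: n; apply: sX; rewrite // divr_gt0.
apply: le_trans h2; apply: le_measure; rewrite ?inE.
- by apply: msmall; exact: measurable_funM.
- exact: msmall.
move=> w /=; rewrite normrM => h; rewrite mulrAC ler_pdivrMr//.
by rewrite (le_trans h)// [`|c n| * _]mulrC ler_wpM2l.
Unshelve. all: by end_near. Qed.

Lemma small_det (c : nat -> R) :
  (forall delta : R, 0 < delta -> \forall n \near \oo, `|c n| <= delta * rho n) ->
  small (fun n _ => c n).
Proof.
move=> hc delta gamma d0 g0; near=> n.
have r0 : 0 < rho n by near: n; exact: near_rho_gt0.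
have h : `|c n| <= delta / 2 * rho n by near: n; apply: hc; rewrite divr_gt0.
rewrite (_ : [set w | _] = set0); first by rewrite measure0 lee_fin ltW.
apply/seteqP; split=> w //= h2; have := le_trans h2 h.
by rewrite ler_pM2r//; lra.
Unshelve. all: by end_near. Qed.

Lemma small_mean (X : forall n, T n -> R) (r : nat -> R) :
  (forall n w, 0 <= X n w) ->
  (forall n, (P n).-integrable setT (EFin \o X n)) ->
  (\forall n \near \oo, Ex (P n) (X n) <= r n) ->
  (forall delta : R, 0 < delta -> \forall n \near \oo, r n <= delta * rho n) ->
  small X.
Proof.
move=> X0 iX Er hr delta gamma d0 g0; near=> n.
have r0 : 0 < rho n by near: n; exact: near_rho_gt0.
have c0 : 0 < delta * rho n by rewrite mulr_gt0.
rewrite (_ : [set w | _] = [set w | delta * rho n <= X n w]); last first.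
  by apply/seteqP; split=> w /=; rewrite ger0_norm.
apply: le_trans (probability_ge_le (X0 n) (iX n) c0) _.
rewrite lee_fin ler_pdivrMr//.
have h1 : Ex (P n) (X n) <= r n by near: n.
have h2 : r n <= (gamma * delta) * rho n by near: n; apply: hr; rewrite mulr_gt0.
by rewrite mulrA (le_trans h1).
Unshelve. all: by end_near. Qed.

(** A second moment of order [rho n / n] is negligible with respect to
    [rho n ^+ 2], since [n * rho n] tends to infinity. *)
Lemma small_variance (X : forall n, T n -> R) (C : R) :
  (forall n, sqint (P n) (X n)) -> 
  (\forall n \near \oo, Ex (P n) (fun w => X n w ^+ 2) <= C * rho n / n%:R) ->
  small X.
Proof.
move=> hX EX delta gamma d0 g0; near=> n.
have r0 : 0 < rho n by near: n; exact: near_rho_gt0.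
have n0 : 0 < n%:R :> R by rewrite ltr0n; near: n; exists 1%N.
have c0 : 0 < delta * rho n by rewrite mulr_gt0.
apply: le_trans (chebyshev_le (hX n) c0) _.
rewrite lee_fin ler_pdivrMr ?exprn_gt0//.
have h1 : Ex (P n) (fun w => X n w ^+ 2) <= C * rho n / n%:R by near: n.
apply: (le_trans h1); rewrite ler_pdivrMr//.
have h2 : C / (gamma * delta ^+ 2) <= n%:R * rho n by near: n; exact: n_rho.
have gd : 0 < gamma * delta ^+ 2 by rewrite mulr_gt0 ?exprn_gt0.
rewrite ler_pdivrMr// in h2.
have /= h3 := ler_wpM2r (ltW r0) h2.
by rewrite (le_trans h3)// le_eqVlt; apply/orP; left; apply/eqP; ring.
Unshelve. all: by end_near. Qed.

(** When [|L - rho| < rho / 2], the denominator [L] is positive and at least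
    [rho / 2]; so the quotient is small as soon as [X] is small against [rho]. *)
Lemma little_op_small (X L : forall n, T n -> R) :
  (forall n, measurable_fun setT (X n)) -> (forall n, measurable_fun setT (L n)) ->
  small X -> small (fun n w => L n w - rho n) -> little_op P X L.
Proof.
move=> mX mL sX sL e e0.
pose S n := [set w | L n w = 0 \/ e < `|X n w / L n w|].
pose B n := [set w | 2^-1 * rho n <= `|L n w - rho n|] `|`
            [set w | e / 2 * rho n <= `|X n w|].
have mLr n : measurable_fun setT (fun w => L n w - rho n).
  by apply: measurable_funB.
have mS n : measurable (S n).
  rewrite (_ : S n = (L n @^-1` [set 0]) `|`
      (fun w => `|X n w| - e * `|L n w|) @^-1` `]0, +oo[).
    apply: measurableU; rewrite -[X in measurable X]setTI.
      exact: mL.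
    apply: measurable_funB => //; first exact: measurableT_comp.
    by apply: measurable_funM => //; exact: measurableT_comp.
  apply/seteqP; split=> w /=; rewrite in_itv/= andbT subr_gt0.
    move=> [h|h]; first by left.
    have [L0|L0] := eqVneq (L n w) 0; first by left.
    by right; move: h; rewrite normrM normfV ltr_pdivlMr ?normr_gt0.
  move=> [h|h]; first by left.
  have [L0|L0] := eqVneq (L n w) 0; first by left.
  by right; rewrite normrM normfV ltr_pdivlMr ?normr_gt0.
have mB n : measurable (B n) by apply: measurableU; exact: msmall.
have key (gamma : R) : 0 < gamma -> \forall n \near \oo, (P n (S n) <= gamma%:E)%E.
  move=> g0; near=> n.
  have r0 : 0 < rho n by near: n; exact: near_rho_gt0.
  have h1 : (P n [set w | (2^-1 * rho n <= `|L n w - rho n|)%R] <= (gamma / 2)%:E)%E.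
    by near: n; apply: sL; rewrite ?invr_gt0// divr_gt0.
  have h2 : (P n [set w | (e / 2 * rho n <= `|X n w|)%R] <= (gamma / 2)%:E)%E.
    by near: n; apply: sX; rewrite divr_gt0.
  rewrite [gamma]splitr EFinD; apply: le_trans (leeD h1 h2).
  apply: le_trans (measureU2 (P n) _ _); [|exact: msmall..].
  apply: le_measure; rewrite ?inE; [exact: mS|exact: mB|].
  move=> w /= hS; apply: contrapT => /not_orP[/negP].
  rewrite -ltNge => l1 /negP; rewrite -ltNge => l2.
  have L1 : 2^-1 * rho n < L n w.
    by move: l1; rewrite ltr_distl => /andP[l1 _]; lra.
  have L0 : 0 < L n w by apply: lt_trans L1; rewrite mulr_gt0 ?invr_gt0.
  case: hS => [h|]; first by rewrite h ltxx in L0.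
  rewrite normrM normfV ltr_pdivlMr ?normr_gt0 ?gt_eqF// (gtr0_norm L0).
  move=> h; have h3 := ltr_pM2l e0 (2^-1 * rho n) (L n w).
  by rewrite L1 in h3; lra.
apply: cvg_EFin; first by apply: nearW => n; exact: fin_num_measure (mS n).
apply/cvgr0Pnorm_le => gamma g0; near=> n.
have h : (P n (S n) <= gamma%:E)%E by near: n; exact: key.
rewrite /= ger0_norm ?fine_ge0//.
by rewrite -lee_fin fineK ?fin_num_measure//; exact: mS.
Unshelve. all: by end_near. Qed.

End Small.

(** * From second moments to the two scores *)

(** Here [rho] is the risk, [e2] stands for [|eps|^2 / n] and [s2] for the error
    variance; the losses and scores enter only through the moment bounds that
    they satisfy. *)
Section ScoreAsymptotics.
Context {R : realType} {d : nat -> measure_display}.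
Context {T : forall n, measurableType (d n)}.
Variables (P : forall n, probability (T n) R) (rho : nat -> R).
Hypothesis n_rho : forall A : R, \forall n \near \oo, A <= n%:R * rho n.
Variables (L1 L2 U e2 : forall n, T n -> R) (s2 C : R).
Arguments L1 n _ : clear implicits.
Arguments L2 n _ : clear implicits.
Arguments U n _ : clear implicits.
Arguments e2 n _ : clear implicits.
Hypothesis s2_gt0 : 0 < s2.
Hypothesis L1_sqint : forall n, sqint (P n) (L1 n).
Hypothesis L2_sqint : forall n, sqint (P n) (L2 n).
Hypothesis U_sqint : forall n, sqint (P n) (U n).
Hypothesis e2_sqint : forall n, sqint (P n) (e2 n).
Hypothesis var_L1 : \forall n \near \oo,
  Ex (P n) (fun w => (L1 n w - rho n) ^+ 2) <= C * rho n / n%:R.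
Hypothesis var_U : \forall n \near \oo,
  Ex (P n) (fun w => (U n w - L1 n w - e2 n w) ^+ 2) <= C * rho n / n%:R.
Hypothesis var_e2 : \forall n \near \oo,
  Ex (P n) (fun w => (e2 n w - s2) ^+ 2) <= 2 * s2 ^+ 2 / n%:R.
Hypothesis L2_le_L1 : forall n w, L2 n w <= L1 n w.
Hypothesis Ex_L1_L2 : forall delta : R, 0 < delta ->
  \forall n \near \oo, Ex (P n) (fun w => L1 n w - L2 n w) <= delta * rho n.

Let sqintB n (X Y : T n -> R) : sqint (P n) X -> sqint (P n) Y ->
  sqint (P n) (fun w => X w - Y w).
Proof.
move=> hX hY; rewrite (_ : (fun w => _) = fun w => X w + -1 * Y w).
  by apply: sqintD => //; exact: sqintZ.
by apply/funext => w; rewrite mulN1r.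
Qed.

Let D n (w : T n) := U n w - L2 n w - e2 n w.
Arguments D n _ : clear implicits.

Let D_sqint n : sqint (P n) (D n). Proof. by do 2 (apply: sqintB => //). Qed.

Let small_L1_L2 : small P rho (fun n w => L1 n w - L2 n w).
Proof.
apply: (small_mean n_rho (r := fun n => Ex (P n) (fun w => L1 n w - L2 n w))) => //.
- by move=> n w; rewrite subr_ge0.
- by move=> n; apply: sqint_itg; exact: sqintB.
- exact: nearW.
Qed.

(** [L2] inherits the concentration of [L1] around [rho]. *)
Let small_L2 : small P rho (fun n w => L2 n w - rho n).
Proof.
have sc n : sqint (P n) (fun=> rho n) := sqint_cst _ _.
apply: (@small_sub _ _ _ _ _ _
  (fun n w => (L1 n w - rho n) + -1 * (L1 n w - L2 n w))).
- by move=> n; have [] := sqintB (L2_sqint n) (sc n).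
- move=> n; have [] // := sqintD (sqintB (L1_sqint n) (sc n))
    (sqintZ (-1) (sqintB (L1_sqint n) (L2_sqint n))).
- by apply: nearW => n w; rewrite le_eqVlt; apply/orP; left; apply/eqP; congr `|_|; ring.
apply: smallD.
- by move=> n; have [] := sqintB (L1_sqint n) (sc n).
- by move=> n; have [] := sqintZ (-1) (sqintB (L1_sqint n) (L2_sqint n)).
- by apply: (small_variance n_rho) var_L1 => n; exact: sqintB.
- apply: (@smallZ _ _ _ _ _ (fun=> -1) 1) => //.
    by apply: nearW => n; rewrite normrN normr1.
  by move=> n; have [] := sqintB (L1_sqint n) (L2_sqint n).
Qed.

Let small_D : small P rho D.
Proof.
apply: (@small_sub _ _ _ _ _ _
  (fun n w => (U n w - L1 n w - e2 n w) + (L1 n w - L2 n w))).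
- by move=> n; have [] := D_sqint n.
- by move=> n; have [] := sqintD (sqintB (sqintB (U_sqint n) (L1_sqint n)) (e2_sqint n))
    (sqintB (L1_sqint n) (L2_sqint n)).
- by apply: nearW => n w; rewrite le_eqVlt; apply/orP; left; apply/eqP; congr `|_|; rewrite /D; ring.
apply: smallD => //.
- by move=> n; have [] := sqintB (sqintB (U_sqint n) (L1_sqint n)) (e2_sqint n).
- by move=> n; have [] := sqintB (L1_sqint n) (L2_sqint n).
- by apply: (small_variance n_rho) var_U => n; do 2 (apply: sqintB => //).
Qed.

Lemma little_op_unbiased_risk : little_op P D L2.
Proof.
apply: (little_op_small n_rho) => // n; first by have [] := D_sqint n.
by have [] := L2_sqint n.
Qed.

(** In the application [a] is [tr A / n].  Writing
    [k] for [(1 - a)^-2 - 1], which is [2 a + O(a^2)], the difference between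
    the errors of [V] and [U] consists of [k] times quantities that are known
    to be small, of [k] times the fluctuation of [|eps|^2 / n], and of a
    deterministic remainder of order [a rho + a^2]. *)
Variables (V : forall n, T n -> R) (a : nat -> R).
Arguments V n _ : clear implicits.
Hypothesis V_measurable : forall n, measurable_fun setT (V n).
Hypothesis a_small : forall delta : R, 0 < delta ->
  \forall n \near \oo, 0 <= a n <= delta /\ s2 * a n ^+ 2 <= delta * rho n.
Hypothesis V_def : \forall n \near \oo, forall w,
  V n w = (U n w - 2 * s2 * a n) / (1 - a n) ^+ 2.

Let k n := ((1 - a n) ^+ 2)^-1 - 1.

(** The relative inflation [(1 - x)^-2 - 1] equals [x (2 - x) / (1 - x)^2], and
    differs from [2 x] by [x^2 (3 - 2 x) / (1 - x)^2]; for [x <= 1/2] the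
    denominators are at least [1/4]. *)
Lemma inflation_bounds (x : R) : 0 <= x <= 2^-1 ->
  0 <= ((1 - x) ^+ 2)^-1 - 1 <= 8 * x /\
  `|((1 - x) ^+ 2)^-1 - 1 - 2 * x| <= 12 * x ^+ 2.
Proof.
move=> /andP[x0 x1].
have y1 : 2^-1 <= 1 - x by lra.
have y0 : 0 < (1 - x) ^+ 2 by rewrite exprn_gt0//; lra.
have y4 : 1 <= 4 * (1 - x) ^+ 2 by nra.
have kE : ((1 - x) ^+ 2)^-1 - 1 = x * (2 - x) / (1 - x) ^+ 2.
  by field; lra.
have kE2 : ((1 - x) ^+ 2)^-1 - 1 - 2 * x = x ^+ 2 * (3 - 2 * x) / (1 - x) ^+ 2.
  by field; lra.
rewrite kE2 kE; split.
  apply/andP; split; first by rewrite divr_ge0 ?(ltW y0)// mulr_ge0//; lra.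
  by rewrite ler_pdivrMr//; nra.
rewrite ger0_norm; last by rewrite divr_ge0 ?(ltW y0)// mulr_ge0 ?sqr_ge0//; lra.
rewrite ler_pdivrMr//; have := sqr_ge0 x; nra.
Qed.

(* The constant 100 leaves room: the terms add up to 36 [u]. *)
Lemma remainder_le (x y z u : R) : 0 <= x <= 8 * u -> `|y| <= 12 * u ->
  0 <= z <= 8 * u -> `|x + y - 2 * z| <= 100 * u.
Proof.
move=> /andP[x0 x1]; rewrite !ler_norml => /andP[y0 y1] /andP[z0 z1].
by apply/andP; split; lra.
Qed.

Lemma little_op_gcv : little_op P (fun n w => V n w - L2 n w - e2 n w) L2.
Proof.
have mL2 n : measurable_fun setT (L2 n) by have [] := L2_sqint n.
have me n : measurable_fun setT (e2 n) by have [] := e2_sqint n.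
have mX n : measurable_fun setT (fun w => V n w - L2 n w - e2 n w).
  by do 2 (apply: measurable_funB => //).
apply: (little_op_small n_rho) => //.
have k_bounds : \forall n \near \oo, [/\ 0 <= a n <= 2^-1, 0 <= k n <= 8 * a n
    & `|k n - 2 * a n| <= 12 * a n ^+ 2].
  near=> n; have : 0 <= a n <= 2^-1 /\ s2 * a n ^+ 2 <= 2^-1 * rho n.
    by near: n; apply: a_small; rewrite invr_gt0.
  by case=> h _; have [h1 h2] := inflation_bounds h.
have k4 : \forall n \near \oo, `|k n| <= 4.
  near=> n; have [/andP[h1 h2] /andP[h3 h4] _] : [/\ 0 <= a n <= 2^-1,
      0 <= k n <= 8 * a n & `|k n - 2 * a n| <= 12 * a n ^+ 2] by near: n.
  by rewrite ger0_norm//; lra.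
pose c n := k n * rho n + s2 * (k n - 2 * a n) - 2 * s2 * a n * k n.
pose X1 n w := (1 + k n) * D n w.
pose X2 n w := k n * (L2 n w - rho n).
pose X3 n w := k n * (e2 n w - s2).
have s1 n : sqint (P n) (X1 n) by exact: sqintZ.
have s2' n : sqint (P n) (X2 n) by apply: sqintZ; apply: sqintB => //; exact: sqint_cst.
have s3 n : sqint (P n) (X3 n) by apply: sqintZ; apply: sqintB => //; exact: sqint_cst.
have m12 n : measurable_fun setT (fun w => X1 n w + X2 n w).
  by have [] := sqintD (s1 n) (s2' n).
have m123 n : measurable_fun setT (fun w => X1 n w + X2 n w + X3 n w).
  by have [] := sqintD (sqintD (s1 n) (s2' n)) (s3 n).
apply: (@small_sub _ _ _ _ _ _ (fun n w => X1 n w + X2 n w + X3 n w + c n)) => //.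
- by move=> n; apply: measurable_funD.
- near=> n => w.
  have hV : V n w = (U n w - 2 * s2 * a n) / (1 - a n) ^+ 2.
    by move: w; near: n.
  rewrite le_eqVlt; apply/orP; left; apply/eqP; congr `|_|.
  by rewrite hV /X1 /X2 /X3 /c /D /k; ring.
apply: smallD => //.
- apply: smallD => //; [by move=> n; case: (s3 n)| |].
    apply: smallD => //; [by move=> n; case: (s1 n)|by move=> n; case: (s2' n)| |].
      apply: (@smallZ _ _ _ _ _ (fun n => 1 + k n) 5) => //.
        near=> n; have h : `|k n| <= 4 by near: n.
        by rewrite (le_trans (ler_normD _ _))// normr1; lra.
      by move=> n; have [] := D_sqint n.
    apply: (@smallZ _ _ _ _ _ k 4) => // n.
    by apply: measurable_funB.
  apply: (@small_variance _ _ _ _ _ n_rho _ (128 * s2)) => //.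
  near=> n.
  have r0 : 0 < rho n by near: n; exact: (near_rho_gt0 n_rho).
  have n0 : 0 < n%:R :> R by rewrite ltr0n; near: n; exists 1%N.
  have [/andP[h1 h2] /andP[h3 h4] _] : [/\ 0 <= a n <= 2^-1,
      0 <= k n <= 8 * a n & `|k n - 2 * a n| <= 12 * a n ^+ 2] by near: n.
  have [_ h5] : 0 <= a n <= 1 /\ s2 * a n ^+ 2 <= 1 * rho n.
    by near: n; exact: a_small.
  have he : Ex (P n) (fun w => (e2 n w - s2) ^+ 2) <= 2 * s2 ^+ 2 / n%:R by near: n.
  rewrite (_ : Ex _ _ = k n ^+ 2 * Ex (P n) (fun w => (e2 n w - s2) ^+ 2)); last first.
    rewrite -ExZ; last by have [] := sqintB (e2_sqint n) (sqint_cst (P n) s2).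
    by apply: eq_Ex => w; rewrite /X3 exprMn.
  apply: (le_trans (ler_wpM2l (sqr_ge0 (k n)) he)).
  rewrite mulrA ler_pM2r ?invr_gt0//.
  have k2 : k n ^+ 2 <= 64 * a n ^+ 2 by nra.
  have h6 := ler_wpM2r (ltW s2_gt0) k2.
  have h7 : s2 * (k n ^+ 2 * s2) <= s2 * (64 * rho n).
    by rewrite ler_pM2l//; lra.
  by lra.
- apply: (@small_det _ _ _ P _ n_rho c) => delta d0; near=> n.
  have r0 : 0 < rho n by near: n; exact: (near_rho_gt0 n_rho).
  have [/andP[h1 h2] /andP[h3 h4] h8] : [/\ 0 <= a n <= 2^-1,
      0 <= k n <= 8 * a n & `|k n - 2 * a n| <= 12 * a n ^+ 2] by near: n.
  have [/andP[_ h5] h6] : 0 <= a n <= delta / 100 /\ s2 * a n ^+ 2 <= delta / 100 * rho n.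
    by near: n; apply: a_small; rewrite divr_gt0.
  pose u := delta / 100 * rho n.
  have t1 : 0 <= k n * rho n <= 8 * u.
    rewrite mulr_ge0 ?(ltW r0)//= mulrA ler_pM2r//.
    by rewrite (le_trans h4)// ler_pM2l.
  have t2 : `|s2 * (k n - 2 * a n)| <= 12 * u.
    rewrite normrM (gtr0_norm s2_gt0) (le_trans (ler_wpM2l (ltW s2_gt0) h8))//.
    by rewrite mulrCA ler_pM2l.
  have t3 : 0 <= s2 * (a n * k n) <= 8 * u.
    rewrite !mulr_ge0 ?(ltW s2_gt0)//=.
    apply: (@le_trans _ _ (8 * (s2 * a n ^+ 2))); last by rewrite ler_pM2l.
    by rewrite [leRHS]mulrCA ler_pM2l// expr2 mulrCA ler_wpM2l.
  have -> : delta * rho n = 100 * u by rewrite /u; field.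
  rewrite /c -[2 * s2 * a n * k n]mulrA -[2 * s2 * _]mulrA.
  exact: remainder_le t1 t2 t3.
Unshelve. all: by end_near. Qed.

End ScoreAsymptotics.

(** * The theorem *)

(** The form at [y] is the seminorm of the combination of the [xi j] with
    coefficients [y]. *)
Lemma gram_seminorm_psd (R : realType) (X : Type) (H : {pred X -> R})
    (J : (X -> R) -> (X -> R) -> R) q (xi : 'I_q -> X -> R) :
  square_seminorm H J -> (forall j, xi j \in H) ->
  psdmx (\matrix_(j, k) J (xi j) (xi k)).
Proof.
move=> [[H0 Hlin] Jsym Jlin Jpos] xiH.
have J0 h : h \in H -> J 0 h = 0.
  move=> hH; have := Jlin 1 0 0 h H0 H0 hH; rewrite scaler0 addr0 mul1r.
  by move/eqP; rewrite -subr_eq0 opprD addrA subrr sub0r oppr_eq0 => /eqP.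
have HS (s : seq 'I_q) (c : 'I_q -> R) : \sum_(j <- s) c j *: xi j \in H.
  elim: s => [|j s ih]; first by rewrite big_nil.
  by rewrite big_cons; exact: Hlin.
have JS (s : seq 'I_q) (c : 'I_q -> R) h : h \in H ->
    J (\sum_(j <- s) c j *: xi j) h = \sum_(j <- s) c j * J (xi j) h.
  move=> hH; elim: s => [|j s ih]; first by rewrite !big_nil J0.
  by rewrite !big_cons Jlin// ih.
apply: psdmxI => [|y].
  by apply/matrixP => j k; rewrite !mxE Jsym.
pose v := \sum_j y j 0 *: xi j.
have vH : v \in H by exact: HS.
rewrite (_ : quad _ y = J v v); first exact: Jpos.
rewrite {1}/v JS// -[LHS]/(bil _ _ _) bilE; apply: eq_bigr => i _.
rewrite Jsym// /v JS// mulr_sumr; apply: eq_bigr => j _.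
by rewrite mxE Jsym//; ring.
Qed.

(** Meant for the averages [a] of the eigenvalues of the smoothing matrices and
    [t] of their squares.  As the eigenvalues lie in [[0, 1]], [t <= a], so
    that [a^2 = o(t)] forces [a] to vanish.  The second hypothesis covers the
    indices where the quotient is [0] by the convention on division. *)
Lemma mean_trace_small (R : realType) (a t : nat -> R) :
  (forall n, 0 <= t n <= a n) -> (forall n, t n = 0 -> a n = 0) ->
  (fun n => a n ^+ 2 / t n) @ \oo --> (0 : R) ->
  forall delta : R, 0 < delta ->
  \forall n \near \oo, 0 <= a n <= delta /\ a n ^+ 2 <= delta * t n.
Proof.
move=> ta t0 /cvgr0Pnorm_le h delta d0; near=> n.
have [t1 t2] := andP (ta n).
have hn : `|a n ^+ 2 / t n| <= delta by near: n; exact: h.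
have a2 : a n ^+ 2 <= delta * t n.
  have [tn|tn] := eqVneq (t n) 0; first by rewrite t0// tn expr0n mulr0.
  have tp : 0 < t n by rewrite lt_def tn.
  by move: hn; rewrite ger0_norm ?divr_ge0 ?sqr_ge0// ler_pdivrMr.
split=> //; have a0 : 0 <= a n by exact: le_trans t1 t2.
rewrite a0 /=; have [an|an] := eqVneq (a n) 0; first by rewrite an ltW.
have ap : 0 < a n by rewrite lt_def an.
rewrite -(ler_pM2r ap) -expr2 (le_trans a2)// ler_pM2l//.
Unshelve. all: by end_near. Qed.

Theorem theorem4p3 (R : realType) (X : Type)
    (eta : X -> R) (sigma : R)
    (H : {pred X -> R}) (J : (X -> R) -> (X -> R) -> R)
    (p q : nat -> nat)
    (x : forall n, 'I_n -> X)
    (z : forall n, 'I_n -> 'cV[R]_(p n))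
    (B : forall n, 'M[R]_(p n))
    (xi : forall n, 'I_(q n) -> X -> R)
    (d : nat -> measure_display) (T : forall n, measurableType (d n))
    (P : forall n, probability (T n) R)
    (b : forall n, 'I_(p n) -> {RV (P n) >-> R})
    (eps : forall n, 'I_n -> {RV (P n) >-> R})
    (lambda : nat -> R) (Sigma : forall n, 'M[R]_(p n))
    (sigma_gt0 : 0 < sigma)
    (J_seminorm : square_seminorm H J)
    (xi_dom : forall n (j : 'I_(q n)), xi n j \in H)
    (B_psd : forall n, psdmx (B n))
    (B_bounded : exists C : R,
       forall n (a : R), eigenvalue (B n) a -> a <= C)
    (b_normal : forall n, is_mvnormal (b n) 0 (B n))
    (eps_normal : forall n (i : 'I_n),
       has_normal_law (P n) (eps n i) 0 (sigma ^+ 2))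
    (eps_b_indep : forall n,
       mutually_independent (P n) (model_sigma (eps n) (b n)))
    (lambda_gt0 : forall n, 0 < lambda n)
    (Sigma_pd : forall n, pdmx (Sigma n)) :
  let etav n : 'cV[R]_n := \col_i eta (x n i) in
  let Z n : 'M[R]_(n, p n) := \matrix_(i, j) z n i j 0 in
  let Rm n : 'M[R]_(n, q n) := \matrix_(i, j) xi n j (x n i) in
  let Q n : 'M[R]_(q n) := \matrix_(j, k) J (xi n j) (xi n k) in
  let Y n (w : T n) : 'cV[R]_n :=
    etav n + Z n *m rvec (b n) w + rvec (eps n) w in
  let A n := smooth_mx (Rm n) (Z n) (Q n) (lambda n) (Sigma n) in
  let At n := smooth_mx_fixed (Rm n) (Q n) (lambda n) in
  let L1 n (w : T n) :=
    loss1 (Rm n) (Z n) (Q n) (lambda n) (Sigma n) (etav n) (rvec (b n) w)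
          (Y n w) in
  let L2 n (w : T n) :=
    loss2 (Rm n) (Z n) (Q n) (lambda n) (Sigma n) (etav n) (Y n w) in
  let R1 n : R := fine 'E_(P n)[L1 n] in
  let R2 n : R := fine 'E_(P n)[L2 n] in
  let U n (w : T n) :=
    score_U (Rm n) (Z n) (Q n) (lambda n) (Sigma n) sigma (Y n w) in
  let V n (w : T n) :=
    score_V (Rm n) (Z n) (Q n) (lambda n) (Sigma n) (Y n w) in
  let epsSq n (w : T n) : R :=
    n%:R^-1 * ((rvec (eps n) w)^T *m rvec (eps n) w) 0 0 in
  (forall n,
     normal_solvable (Rm n) (Z n) (Q n) (lambda n) (Sigma n)) ->
  (exists C : R, forall n (a : R),
     eigenvalue (Sigma n
                 *m invmx ((Z n)^T *m (1%:M - At n) *m Z n + Sigma n)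
                 *m Sigma n) a -> a <= C) ->
  (fun n => n%:R * R1 n) @ \oo --> +oo ->
  (fun n => R1 n - R2 n) =o_\oo R1 ->
  little_op P (fun n w => U n w - L2 n w - epsSq n w) L2
  /\ ((fun n => (n%:R^-1 * \tr (A n)) ^+ 2
                / (n%:R^-1 * \tr (A n *m A n))) @ \oo --> (0 : R) ->
      little_op P (fun n w => V n w - L2 n w - epsSq n w) L2).

Proof.
move=> etav Z Rm Q Y A At L1 L2 R1 R2 U V epsSq _ [C0 hC0] nR1 R12.
have [CB0 hCB0] := B_bounded.
pose C1 := Num.max C0 0; pose CB := Num.max CB0 0.
have Qpsd n : psdmx (Q n) by exact: gram_seminorm_psd (xi_dom n).
have l0 n : 0 <= lambda n by exact: ltW.
have gK n : gauss_vec (P n) (noise (b n) (eps n)) (noise_cov n (B n) sigma).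
  by apply: noise_gauss_vec => //; exact: eps_normal.
have B_le n y : quad (B n) y <= CB * normsq y.
  apply: (le_trans (eigenvalue_quad_le (psdmx_sym (B_psd n)) (hCB0 n) y)).
  by rewrite ler_wpM2r ?normsq_ge0// le_max lexx.
have Z_le n v : normsq ((1%:M - A n) *m (Z n *m v)) <= C1 * normsq v.
  rewrite /A smooth_mxE.
  have pS := penalty_psd (n := n) (Qpsd n) (l0 n).
  have h := mixed_residual_le pS (Sigma_pd n) v (hC0 n); apply: (le_trans h).
  by rewrite ler_wpM2r ?normsq_ge0// le_max lexx.
have C10 : 0 <= C1 by rewrite le_max lexx orbT.
have CB1 : 0 <= CB by rewrite le_max lexx orbT.
pose fe n w := fit_error (Rm n) (Z n) (Q n) (lambda n) (Sigma n) (etav n)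
  (rvec (b n) w) (rvec (eps n) w).
pose rk n := risk (Rm n) (Z n) (Q n) (lambda n) (Sigma n) (B n) sigma (etav n).
pose sc n := score_error (Rm n) (Z n) (Q n) (lambda n) (Sigma n) sigma (etav n)
  (b n) (eps n).
have L1E n w : L1 n w = n%:R^-1 * normsq (fe n w) by exact: loss1E.
have L2E n w : L2 n w = n%:R^-1 * normsq ((1%:M - proj_range (Z n)) *m fe n w).
  exact: loss2E.
have UE n w : U n w - L1 n w - epsSq n w = n%:R^-1 * sc n w.
  by rewrite L1E /U /score_U /epsSq /sc /score_error -/(fe n w) -/(A n) /normsq; ring.
have fe_sqint n : sqint (P n) (fun w => normsq (fe n w)).
  exact: normsq_error_sqint (gK n).
have L1_sqint n : sqint (P n) (L1 n).
  by rewrite (funext (L1E n)); exact: sqintZ.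
have L2_sqint n : sqint (P n) (L2 n).
  rewrite (funext (L2E n)); apply: sqintZ.
  exact: normsq_mul_error_sqint (gK n) _.
have sc_sqint n : sqint (P n) (sc n).
  exact: score_error_sqint (Qpsd n) (l0 n) (Sigma_pd n) _ _ _ _ _ (gK n).
have ExE n (W : T n -> R) : fine 'E_(P n)[W] = Ex (P n) W.
  by rewrite expectation.unlock.
have n0 n : 0 <= n%:R^-1 :> R by rewrite invr_ge0.
have R1E n : R1 n = n%:R^-1 * rk n.
  rewrite /R1 ExE (eq_Ex _ (L1E n)) ExZ; last exact: sqint_itg.
  by rewrite (Ex_normsq_error _ _ _ _ _ _ (gK n)).
have R1_ge0 n : 0 <= R1 n.
  rewrite /R1 ExE; apply: Ex_ge0 => w.
  by rewrite L1E mulr_ge0// normsq_ge0.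
have n_rho : forall M : R, \forall n \near \oo, M <= n%:R * R1 n.
  by move/cvgryPge: nR1.
have scaleE n (W : T n -> R) : sqint (P n) W ->
    Ex (P n) (fun w => (n%:R^-1 * W w) ^+ 2) =
    n%:R^-1 ^+ 2 * Ex (P n) (fun w => W w ^+ 2).
  move=> [_ iW]; rewrite -ExZ//.
  by apply: eq_Ex => w; rewrite exprMn.
have sg := sqr_ge0 sigma.
pose C := 8 * (CB * C1 + sigma ^+ 2) + 16 * sigma ^+ 2.
have rkn n : C * R1 n / n%:R = n%:R^-1 ^+ 2 * (C * rk n).
  by rewrite R1E; ring.
have rk_ge0 n : 0 <= rk n.
  by rewrite /rk /risk addr_ge0 ?normsq_ge0//; exact: trKr_ge0.
have var_L1 n : Ex (P n) (fun w => (L1 n w - R1 n) ^+ 2) <= C * R1 n / n%:R.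
  rewrite (_ : Ex _ _ = Ex (P n) (fun w => (n%:R^-1 * (normsq (fe n w) - rk n)) ^+ 2)).
    rewrite scaleE; last by apply: sqintD => //; exact: sqint_cst.
    rewrite rkn ler_wpM2l ?sqr_ge0//.
    apply: (le_trans (var_normsq_error _ (Qpsd n) (l0 n) (Sigma_pd n) (B_psd n)
      (gK n) CB1 C10 (B_le n) (Z_le n))).
    by rewrite -/(rk n) ler_wpM2r// /C lerDl mulr_ge0.
  by apply: eq_Ex => w; rewrite L1E R1E; ring.
have var_U n : Ex (P n) (fun w => (U n w - L1 n w - epsSq n w) ^+ 2) <=
    C * R1 n / n%:R.
  rewrite (_ : Ex _ _ = Ex (P n) (fun w => (n%:R^-1 * sc n w) ^+ 2)).
    rewrite scaleE// rkn ler_wpM2l ?sqr_ge0//.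
    apply: (le_trans (var_score_error _ _ _ (Qpsd n) (l0 n) (Sigma_pd n) (B_psd n) (gK n))).
    by rewrite -/(rk n) ler_wpM2r// /C lerDr mulr_ge0// addr_ge0// mulr_ge0.
  by apply: eq_Ex => w; rewrite UE.
have e_sqint n : sqint (P n) (epsSq n).
  rewrite (_ : epsSq n = fun w => n%:R^-1 *
      ((normsq (rvec (eps n) w) - n%:R * sigma ^+ 2) + n%:R * sigma ^+ 2)).
    by apply: sqintZ; apply: sqintD; [exact: eps_sqr_sqint (gK n)|exact: sqint_cst].
  by apply/funext => w; rewrite subrK.
have U_sqint n : sqint (P n) (U n).
  rewrite (_ : U n = fun w => n%:R^-1 * sc n w + L1 n w + epsSq n w).
    by apply: sqintD => //; apply: sqintD => //; exact: sqintZ.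
  by apply/funext => w; rewrite -UE; ring.
have L2_le n w : L2 n w <= L1 n w.
  by rewrite L1E L2E ler_wpM2l// normsq_proj gerBl normsq_ge0.
have Ex_diff (delta : R) : 0 < delta -> \forall n \near \oo,
    Ex (P n) (fun w => L1 n w - L2 n w) <= delta * R1 n.
  move=> d0; move/eqoP: R12 => /(_ delta d0); apply: filterS => n.
  rewrite (ger0_norm (R1_ge0 n)) => h; apply: le_trans h.
  rewrite /R1 /R2 !ExE ExB; [exact: ler_norm|exact: sqint_itg..].
split.
  apply: (little_op_unbiased_risk n_rho L1_sqint L2_sqint U_sqint e_sqint _ _ L2_le Ex_diff).
  - by apply: nearW => n; exact: var_L1.
  - by apply: nearW => n; exact: var_U.
move=> C3.
pose a n := n%:R^-1 * \tr (A n); pose t n := n%:R^-1 * \tr (A n *m A n).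
have pS n := block_penalty_psd (n := n) (Qpsd n) (l0 n) (Sigma_pd n).
have sA n : (A n)^T = A n by rewrite /A smooth_mxE; exact: ridge_sym.
have ta n : 0 <= t n <= a n.
  rewrite /t /a; apply/andP; split.
    by rewrite mulr_ge0// -{1}(sA n); exact: psd_tr_ge0 (psd_gram _).
  by rewrite ler_wpM2l// /A smooth_mxE; exact: tr_ridge_sqr_le.
have t0 n : t n = 0 -> a n = 0.
  rewrite /t /a => /eqP; rewrite mulf_eq0 => /orP[/eqP->|]; first by rewrite mul0r.
  by rewrite -{1}(sA n) => /eqP/tr_gram_eq0 ->; rewrite mxtrace0 mulr0.
have tR n : sigma ^+ 2 * t n <= R1 n.
  rewrite R1E /t mulrCA ler_wpM2l//.
  apply: (le_trans (tr_sqr_le_risk _ _ _ (Qpsd n) (l0 n) (Sigma_pd n) (B_psd n))).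
  by rewrite /rk /risk lerDr normsq_ge0.
have s20 : 0 < sigma ^+ 2 by rewrite exprn_gt0.
have var_e : \forall n \near \oo,
    Ex (P n) (fun w => (epsSq n w - sigma ^+ 2) ^+ 2) <= 2 * (sigma ^+ 2) ^+ 2 / n%:R.
  near=> n; have nz : n%:R != 0 :> R by rewrite pnatr_eq0 -lt0n; near: n; exists 1%N.
  rewrite (_ : Ex _ _ = Ex (P n) (fun w => (n%:R^-1 *
      (normsq (rvec (eps n) w) - n%:R * sigma ^+ 2)) ^+ 2)).
    rewrite scaleE; last exact: eps_sqr_sqint (gK n).
    rewrite (var_eps_sqr (gK n)) le_eqVlt; apply/orP; left; apply/eqP.
    by field.
  by apply: eq_Ex => w; rewrite mulrBr mulKf.
apply: (@little_op_gcv _ _ _ P R1 n_rho L1 L2 U epsSq (sigma ^+ 2) C s20 L1_sqint L2_sqint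
  U_sqint e_sqint _ _ var_e L2_le Ex_diff V a).
- by apply: nearW => n; exact: var_L1.
- by apply: nearW => n; exact: var_U.
- move=> n; have [mU _] := U_sqint n.
  rewrite (_ : V n = fun w => (U n w - 2 / n%:R * sigma ^+ 2 * \tr (A n)) *
      ((n%:R^-1 * \tr (1%:M - A n)) ^+ 2)^-1).
    by apply: measurable_funM => //; exact: measurable_funB.
  by apply/funext => w; rewrite /V /U /score_V /score_U -/(A n) addrK.
- move=> delta d0; have := mean_trace_small ta t0 C3 d0.
  apply: filterS => n [h1 h2]; split=> //.
  apply: (le_trans (ler_wpM2l sg h2)); rewrite mulrCA ler_pM2l//.
- near=> n; have nz : n%:R != 0 :> R by rewrite pnatr_eq0 -lt0n; near: n; exists 1%N.
  move=> w; rewrite /V /U /score_V /score_U -/(A n) /a.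
  have -> : n%:R^-1 * \tr (1%:M - A n) = 1 - n%:R^-1 * \tr (A n).
    by rewrite raddfB/= mxtrace1 mulrBr mulVf.
  by congr (_ / _); ring.
Unshelve. all: by end_near. Qed.
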